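(* Let $L$ be a locally compact group with neutral element $e_L$ and let $f:\overline{\mathbb D}\times L\to\mathbb C$ be continuous. Then $f\in\mathcal P(\Omega_\infty,L)$ if and only if there exists a double sequence $(\varphi_{m,n})_{m,n\ge0}$ of functions in $\mathcal P(L)$ with $\sum_{m,n=0}^\infty\varphi_{m,n}(e_L)<\infty$ such that $$f(z,u)=\sum_{m,n=0}^\infty\varphi_{m,n}(u)z^m\overline z^n,\quad z\in\overline{\mathbb D},\ u\in L.$$ The series is then uniformly convergent on $\overline{\mathbb D}\times L$.
   Context: A kernel $k:X\times X\to\mathbb C$ is positive definite if $\sum_{j,k=1}^n k(x_j,x_k)c_j\overline{c_k}\ge0$ for all finite choices of points and complex scalars. For a locally compact group $L$, $\mathcal P(L)$ is the set of continuous $\varphi:L\to\mathbb C$ with $(u,v)\mapsto\varphi(u^{-1}v)$ positive definite on $L$. $\overline{\mathbb D}$ is the closed unit disc in $\mathbb C$. For $q\ge2$, $\Omega_{2q}=\{z\in\mathbb C^q:\sum|z_k|^2=1\}$ with hermitian scalar product $\xi\cdot\eta=\sum\xi_k\overline{\eta_k}\in\overline{\mathbb D}$. $\mathcal P(\Omega_{2q},L)$ is the set of continuous $f:\overline{\mathbb D}\times L\to\mathbb C$ such that $((\xi,u),(\eta,v))\mapsto f(\xi\cdot\eta,u^{-1}v)$ is positive definite on $\Omega_{2q}\times L$, and $\mathcal P(\Omega_\infty,L)=\bigcap_{q\ge2}\mathcal P(\Omega_{2q},L)$ (equivalently, the kernel is positive definite on $\Omega_\infty\times L$, $\Omega_\infty$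 the unit sphere of $\ell_2(\mathbb C)$). *)

(* Defs.v *)
From Stdlib Require Import Reals.
Open Scope R_scope.

Definition Cx : Type := (R * R)%type.
Definition C0 : Cx := (0, 0).
Definition RtoC (r : R) : Cx := (r, 0).
Definition Cadd (a b : Cx) : Cx := (fst a + fst b, snd a + snd b).
Definition Csub (a b : Cx) : Cx := (fst a - fst b, snd a - snd b).
Definition Cmul (a b : Cx) : Cx :=
  (fst a * fst b - snd a * snd b, fst a * snd b + snd a * fst b).
Definition Cconj (a : Cx) : Cx := (fst a, - snd a).
Definition Cmod (a : Cx) : R := sqrt (fst a ^ 2 + snd a ^ 2).
Fixpoint Cpow (a : Cx) (n : nat) : Cx :=
  match n with O => RtoC 1 | S k => Cmul (Cpow a k) a end.

Fixpoint csum (n : nat) (g : nat -> Cx) : Cx :=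
  match n with O => C0 | S k => Cadd (csum k g) (g k) end.

Definition in_disc (z : Cx) : Prop := Cmod z <= 1.

Definition Cnonneg (a : Cx) : Prop := snd a = 0 /\ 0 <= fst a.

Definition pos_def_kernel {X : Type} (k : X -> X -> Cx) : Prop :=
  forall (n : nat) (x : nat -> X) (c : nat -> Cx),
    Cnonneg (csum n (fun j => csum n (fun l =>
               Cmul (Cmul (k (x j) (x l)) (c j)) (Cconj (c l))))).

Definition compact_in {T : Type} (is_open : (T -> Prop) -> Prop) (K : T -> Prop) : Prop :=
  forall (I : Type) (O : I -> T -> Prop),
    (forall i, is_open (O i)) ->
    (forall x, K x -> exists i, O i x) ->
    exists l : list I, forall x, K x -> exists i, List.In i l /\ O i x.

Record LCGroup : Type := {
  carrier :> Type;
  gmul : carrier -> carrier -> carrier;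
  ginv : carrier -> carrier;
  gone : carrier;
  gopen : (carrier -> Prop) -> Prop;
  gmulA : forall x y z, gmul x (gmul y z) = gmul (gmul x y) z;
  gmul1l : forall x, gmul gone x = x;
  gmul1r : forall x, gmul x gone = x;
  gmulVl : forall x, gmul (ginv x) x = gone;
  gmulVr : forall x, gmul x (ginv x) = gone;
  gopen_full : gopen (fun _ => True);
  gopen_inter : forall U V, gopen U -> gopen V -> gopen (fun x => U x /\ V x);
  gopen_union : forall (I : Type) (O : I -> carrier -> Prop),
      (forall i, gopen (O i)) -> gopen (fun x => exists i, O i x);
  gmul_cont : forall u v (W : carrier -> Prop), gopen W -> W (gmul u v) ->
      exists U V : carrier -> Prop, gopen U /\ gopen V /\ U u /\ V v /\
        (forall a b, U a -> V b -> W (gmul a b));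
  ginv_cont : forall W, gopen W -> gopen (fun x => W (ginv x));
  ghausdorff : forall x y, x <> y ->
      exists U V : carrier -> Prop, gopen U /\ gopen V /\ U x /\ V y /\
        (forall z, U z -> V z -> False);
  glocally_compact : forall x, exists (U K : carrier -> Prop),
      gopen U /\ U x /\ (forall y, U y -> K y) /\ compact_in gopen K
}.

Arguments gmul {_}. Arguments ginv {_}. Arguments gone {_}. Arguments gopen {_}.

Definition contL {L : LCGroup} (phi : L -> Cx) : Prop :=
  forall (u0 : L) (eps : R), 0 < eps ->
    exists U : L -> Prop, gopen U /\ U u0 /\
      forall u, U u -> Cmod (Csub (phi u) (phi u0)) < eps.

Definition contDL {L : LCGroup} (f : Cx -> L -> Cx) : Prop :=
  forall (z0 : Cx) (u0 : L) (eps : R), in_disc z0 -> 0 < eps ->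
    exists (delta : R) (U : L -> Prop), 0 < delta /\ gopen U /\ U u0 /\
      forall z u, in_disc z -> Cmod (Csub z z0) < delta -> U u ->
        Cmod (Csub (f z u) (f z0 u0)) < eps.

Definition PL {L : LCGroup} (phi : L -> Cx) : Prop :=
  contL phi /\ pos_def_kernel (fun u v : L => phi (gmul (ginv u) v)).

(** Omega_{2q}: unit sphere of Cx^q (only coordinates 0..q-1 matter) *)
Definition herm (q : nat) (xi eta : nat -> Cx) : Cx :=
  csum q (fun k => Cmul (xi k) (Cconj (eta k))).
Definition Omega (q : nat) : Type :=
  { xi : nat -> Cx | csum q (fun k => Cmul (xi k) (Cconj (xi k))) = RtoC 1 }.

Definition P_Omega (q : nat) {L : LCGroup} (f : Cx -> L -> Cx) : Prop :=
  contDL f /\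
  pos_def_kernel (fun (a b : Omega q * L) =>
      f (herm q (proj1_sig (fst a)) (proj1_sig (fst b)))
        (gmul (ginv (snd a)) (snd b))).

Definition P_Omega_inf {L : LCGroup} (f : Cx -> L -> Cx) : Prop :=
  forall q : nat, (2 <= q)%nat -> P_Omega q f.

Definition dpartial {L : LCGroup} (phi : nat -> nat -> L -> Cx) (N : nat) (z : Cx) (u : L) : Cx :=
  csum N (fun m => csum N (fun n =>
    Cmul (phi m n u) (Cmul (Cpow z m) (Cpow (Cconj z) n)))).

(** sum_{m,n} phi_{m,n}(e_L) < infinity (terms are >= 0 reals for pd phi) *)
Definition summable_at_e {L : LCGroup} (phi : nat -> nat -> L -> Cx) : Prop :=
  exists S : R, Un_cv (fun N => fst (csum N (fun m => csum N (fun n => phi m n gone)))) S.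

Definition Cseq_cv (s : nat -> Cx) (l : Cx) : Prop :=
  forall eps, 0 < eps -> exists N, forall M, (N <= M)%nat -> Cmod (Csub (s M) l) < eps.

Definition expansion {L : LCGroup} (phi : nat -> nat -> L -> Cx) (f : Cx -> L -> Cx) : Prop :=
  (forall m n, PL (phi m n)) /\ summable_at_e phi /\
  (forall z u, in_disc z -> Cseq_cv (fun N => dpartial phi N z u) (f z u)).

Definition unif_cv {L : LCGroup} (phi : nat -> nat -> L -> Cx) (f : Cx -> L -> Cx) : Prop :=
  forall eps, 0 < eps -> exists N, forall M, (N <= M)%nat ->
    forall z u, in_disc z -> Cmod (Csub (dpartial phi M z u) (f z u)) < eps.

(* Main.v *)
(** Fix [N] and let [p = 2 N + 1]. The vectors [(w_1, ..., w_N) / sqrt N], with [w_i] running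
    over the [p]-th roots of unity, form a copy of a finite abelian group inside the sphere of
    [C^N], and the Fourier coefficients of [f] restricted to it are positive definite functions
    on [L]. Weight the characters of the group by [z^m * conj z^n], where [m] and [n] are the
    total positive and negative frequencies: the resulting sum of Fourier coefficients equals the
    expectation of [f (mean of y_1, ..., y_N)] for independent roots of unity [y_i] of mean [z]
    (their law is a truncated Poisson kernel, nonnegative once [N] is large). By the law of large
    numbers these polynomials, whose coefficients are positive definite in the group variable,
    converge to [f] on the open disc: a Bernstein approximation of [f]. Limits of the coefficients
    along an ultrafilter give the expansion there. The coefficients at the neutral element are
    summable because [f] is bounded by [f 1 e], so the expansion extends to the closed disc by
    continuity, and the coefficients inherit continuity from that of [f 1] at [e].

    Conversely, multiplying a positive definite kernel by the Gram kernel [xi . eta] or its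
    conjugate preserves positivity. *)

From Coquelicot Require Complex.
From mathcomp Require filter.
Require Import Defs.
From Stdlib Require Import Reals Lra Lia List Classical ClassicalEpsilon.
Import ListNotations.
Open Scope R_scope.

(* Arithmetic of the complex numbers *)
Declare Scope Cx_scope.
Delimit Scope Cx_scope with Cx.
Bind Scope Cx_scope with Cx.
Infix "+" := Cadd : Cx_scope.
Infix "-" := Csub : Cx_scope.
Infix "*" := Cmul : Cx_scope.

Definition Copp (a : Cx) : Cx := (- fst a, - snd a).

Lemma Cx_eq (a b : Cx) : fst a = fst b -> snd a = snd b -> a = b.
Proof. destruct a, b; simpl; congruence. Qed.

Lemma Cx_ring_theory : ring_theory C0 (RtoC 1) Cadd Cmul Csub Copp eq.
Proof. split; intros; apply Cx_eq; simpl; ring. Qed.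

Add Ring Cx_ring : Cx_ring_theory.

Lemma Cconj_add a b : Cconj (a + b)%Cx = (Cconj a + Cconj b)%Cx.
Proof. apply Cx_eq; simpl; ring. Qed.

Lemma Cconj_mul a b : Cconj (a * b)%Cx = (Cconj a * Cconj b)%Cx.
Proof. apply Cx_eq; simpl; ring. Qed.

Lemma Cconj_conj a : Cconj (Cconj a) = a.
Proof. apply Cx_eq; simpl; ring. Qed.

Lemma Cconj_RtoC r : Cconj (RtoC r) = RtoC r.
Proof. apply Cx_eq; simpl; ring. Qed.

Lemma RtoC_mul r s : RtoC (r * s) = (RtoC r * RtoC s)%Cx.
Proof. apply Cx_eq; simpl; ring. Qed.

Lemma RtoC_add r s : RtoC (r + s) = (RtoC r + RtoC s)%Cx.
Proof. apply Cx_eq; simpl; ring. Qed.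

Lemma Cmod_triangle a b : Cmod (a + b)%Cx <= Cmod a + Cmod b.
Proof. exact (Complex.Cmod_triangle a b). Qed.

Lemma Cmod_mul a b : Cmod (a * b)%Cx = Cmod a * Cmod b.
Proof. exact (Complex.Cmod_mult a b). Qed.

Lemma Cmod_ge_0 a : 0 <= Cmod a.
Proof. apply sqrt_pos. Qed.

Lemma Cmod_RtoC r : Cmod (RtoC r) = Rabs r.
Proof. exact (Complex.Cmod_R r). Qed.

Lemma Cmod_RtoC_pos r : 0 <= r -> Cmod (RtoC r) = r.
Proof. intros H; rewrite Cmod_RtoC; apply Rabs_pos_eq, H. Qed.

Lemma Cmod_C0 : Cmod C0 = 0.
Proof. exact Complex.Cmod_0. Qed.

Lemma Cmod_conj a : Cmod (Cconj a) = Cmod a.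
Proof. unfold Cmod; simpl; f_equal; ring. Qed.

Lemma Cmod_sqr a : Cmod a ^ 2 = fst a ^ 2 + snd a ^ 2.
Proof. unfold Cmod; apply pow2_sqrt; nra. Qed.

Lemma Cmod_sub_sym a b : Cmod (a - b)%Cx = Cmod (b - a)%Cx.
Proof. unfold Cmod; simpl; f_equal; ring. Qed.

Lemma Cmod_sub_triangle a b c : Cmod (a - c)%Cx <= Cmod (a - b)%Cx + Cmod (b - c)%Cx.
Proof.
  replace (a - c)%Cx with ((a - b) + (b - c))%Cx by ring; apply Cmod_triangle.
Qed.

Lemma fst_le_Cmod a : Rabs (fst a) <= Cmod a.
Proof. exact (Rle_trans _ _ _ (Rmax_l _ _) (Complex.Rmax_Cmod a)). Qed.

Lemma snd_le_Cmod a : Rabs (snd a) <= Cmod a.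
Proof. exact (Rle_trans _ _ _ (Rmax_r _ _) (Complex.Rmax_Cmod a)). Qed.

Lemma Cmul_conj a : (a * Cconj a)%Cx = RtoC (Cmod a ^ 2).
Proof. rewrite Cmod_sqr; apply Cx_eq; simpl; ring. Qed.

Lemma Cpow_mul a b n : Cpow (a * b)%Cx n = (Cpow a n * Cpow b n)%Cx.
Proof. induction n as [|n IH]; simpl; [ring | rewrite IH; ring]. Qed.

Lemma Cpow_add a m n : Cpow a (m + n) = (Cpow a m * Cpow a n)%Cx.
Proof.
  induction m as [|m IH]; simpl; [ring | rewrite IH; ring].
Qed.

Lemma Cpow_conj a n : Cpow (Cconj a) n = Cconj (Cpow a n).
Proof.
  induction n as [|n IH]; simpl; [now rewrite Cconj_RtoC | now rewrite IH, Cconj_mul].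
Qed.

Lemma Cmod_pow a n : Cmod (Cpow a n) = Cmod a ^ n.
Proof.
  induction n as [|n IH]; simpl.
  { rewrite Cmod_RtoC_pos; lra. }
  { rewrite Cmod_mul, IH; ring. }
Qed.

Lemma Cpow_RtoC r n : Cpow (RtoC r) n = RtoC (r ^ n).
Proof. induction n as [|n IH]; simpl; [reflexivity | rewrite IH, <- RtoC_mul; f_equal; ring]. Qed.

Lemma pow_le_1 r n : 0 <= r <= 1 -> r ^ n <= 1.
Proof. intros H; rewrite <- (pow1 n); apply pow_incr; lra. Qed.

Lemma pow_decr r m n : 0 <= r <= 1 -> (m <= n)%nat -> r ^ n <= r ^ m.
Proof.
  intros Hr Hmn; replace n with (m + (n - m))%nat by lia; rewrite pow_add.
  pose proof (pow_le r m); pose proof (pow_le_1 r (n - m) Hr); nra.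
Qed.

(** * Finite sums and products over lists *)

Definition lsum {I} (l : list I) (F : I -> Cx) : Cx :=
  fold_right (fun i s => (F i + s)%Cx) C0 l.

Definition rsum {I} (l : list I) (F : I -> R) : R :=
  fold_right (fun i s => F i + s) 0 l.

Definition lprod {I} (l : list I) (F : I -> Cx) : Cx :=
  fold_right (fun i s => (F i * s)%Cx) (RtoC 1) l.

Section ListSums.
Context {I J : Type}.
Implicit Types (l : list I) (F G : I -> Cx).

Lemma lsum_app l1 l2 F : lsum (l1 ++ l2) F = (lsum l1 F + lsum l2 F)%Cx.
Proof. induction l1 as [|i l1 IH]; simpl; [ring | rewrite IH; ring]. Qed.

Lemma lsum_map (g : I -> J) l (F : J -> Cx) : lsum (map g l) F = lsum l (fun i => F (g i)).
Proof. induction l as [|i l IH]; simpl; [easy | now rewrite IH]. Qed.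

Lemma lsum_ext l F G : (forall i, In i l -> F i = G i) -> lsum l F = lsum l G.
Proof.
  induction l as [|i l IH]; simpl; intros H; [easy|].
  rewrite H, IH; auto.
Qed.

Lemma lsum_add l F G : lsum l (fun i => F i + G i)%Cx = (lsum l F + lsum l G)%Cx.
Proof. induction l as [|i l IH]; simpl; [ring | rewrite IH; ring]. Qed.

Lemma lsum_sub l F G : lsum l (fun i => F i - G i)%Cx = (lsum l F - lsum l G)%Cx.
Proof. induction l as [|i l IH]; simpl; [ring | rewrite IH; ring]. Qed.

Lemma lsum_mul_l l F c : lsum l (fun i => c * F i)%Cx = (c * lsum l F)%Cx.
Proof. induction l as [|i l IH]; simpl; [ring | rewrite IH; ring]. Qed.

Lemma lsum_mul_r l F c : lsum l (fun i => F i * c)%Cx = (lsum l F * c)%Cx.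
Proof. induction l as [|i l IH]; simpl; [ring | rewrite IH; ring]. Qed.

Lemma lsum_0 l F : (forall i, In i l -> F i = C0) -> lsum l F = C0.
Proof.
  induction l as [|i l IH]; simpl; intros H; [easy|].
  rewrite H, IH by auto; ring.
Qed.

Lemma lsum_conj l F : Cconj (lsum l F) = lsum l (fun i => Cconj (F i)).
Proof.
  induction l as [|i l IH]; simpl.
  { apply Cx_eq; simpl; ring. }
  { now rewrite Cconj_add, IH. }
Qed.

Lemma lsum_fst l F : fst (lsum l F) = rsum l (fun i => fst (F i)).
Proof. induction l as [|i l IH]; simpl; [easy | now rewrite IH]. Qed.

Lemma lsum_snd l F : snd (lsum l F) = rsum l (fun i => snd (F i)).
Proof. induction l as [|i l IH]; simpl; [easy | now rewrite IH]. Qed.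

Lemma RtoC_rsum l (F : I -> R) : RtoC (rsum l F) = lsum l (fun i => RtoC (F i)).
Proof. induction l as [|i l IH]; simpl; [easy | now rewrite RtoC_add, IH]. Qed.

Lemma Cmod_lsum l F : Cmod (lsum l F) <= rsum l (fun i => Cmod (F i)).
Proof.
  induction l as [|i l IH]; simpl; [rewrite Cmod_C0; lra|].
  pose proof (Cmod_triangle (F i) (lsum l F)); lra.
Qed.

Lemma rsum_app l1 l2 (F : I -> R) : rsum (l1 ++ l2) F = rsum l1 F + rsum l2 F.
Proof. induction l1 as [|i l1 IH]; simpl; [ring | rewrite IH; ring]. Qed.

Lemma rsum_map (g : I -> J) l (F : J -> R) : rsum (map g l) F = rsum l (fun i => F (g i)).
Proof. induction l as [|i l IH]; simpl; [easy | now rewrite IH]. Qed.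

Lemma rsum_ext l (F G : I -> R) : (forall i, In i l -> F i = G i) -> rsum l F = rsum l G.
Proof.
  induction l as [|i l IH]; simpl; intros H; [easy|].
  rewrite H, IH; auto.
Qed.

Lemma rsum_le l (F G : I -> R) : (forall i, In i l -> F i <= G i) -> rsum l F <= rsum l G.
Proof.
  induction l as [|i l IH]; simpl; intros H; [lra|].
  assert (F i <= G i) by auto; assert (rsum l F <= rsum l G) by auto; lra.
Qed.

Lemma rsum_ge_0 l (F : I -> R) : (forall i, In i l -> 0 <= F i) -> 0 <= rsum l F.
Proof.
  induction l as [|i l IH]; simpl; intros H; [lra|].
  assert (0 <= F i) by auto; assert (0 <= rsum l F) by auto; lra.
Qed.

Lemma rsum_term_le l (F : I -> R) i :
  (forall i, In i l -> 0 <= F i) -> In i l -> F i <= rsum l F.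
Proof.
  induction l as [|j l IH]; simpl; intros H Hi; [easy|].
  destruct Hi as [-> | Hi].
  { pose proof (rsum_ge_0 l F ltac:(auto)); lra. }
  { pose proof (H j ltac:(auto)); pose proof (IH ltac:(auto) Hi); lra. }
Qed.

Lemma rsum_add l (F G : I -> R) : rsum l (fun i => F i + G i) = rsum l F + rsum l G.
Proof. induction l as [|i l IH]; simpl; [ring | rewrite IH; ring]. Qed.

Lemma rsum_sub l (F G : I -> R) : rsum l (fun i => F i - G i) = rsum l F - rsum l G.
Proof. induction l as [|i l IH]; simpl; [ring | rewrite IH; ring]. Qed.

Lemma rsum_mul_l l (F : I -> R) c : rsum l (fun i => c * F i) = c * rsum l F.
Proof. induction l as [|i l IH]; simpl; [ring | rewrite IH; ring]. Qed.

Lemma lprod_ext l F G : (forall i, In i l -> F i = G i) -> lprod l F = lprod l G.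
Proof.
  induction l as [|i l IH]; simpl; intros H; [easy|].
  rewrite H, IH; auto.
Qed.

End ListSums.

Lemma lsum_swap {I J} (l : list I) (l' : list J) (F : I -> J -> Cx) :
  lsum l (fun i => lsum l' (F i)) = lsum l' (fun j => lsum l (fun i => F i j)).
Proof.
  induction l as [|i l IH]; simpl.
  { now rewrite lsum_0. }
  { now rewrite IH, <- lsum_add. }
Qed.

Lemma lsum_list_prod {I J} (l : list I) (l' : list J) (F : I * J -> Cx) :
  lsum (list_prod l l') F = lsum l (fun i => lsum l' (fun j => F (i, j))).
Proof.
  induction l as [|i l IH]; simpl; [easy|].
  now rewrite lsum_app, lsum_map, IH.
Qed.

Lemma csum_lsum n g : csum n g = lsum (seq 0 n) g.
Proof.
  induction n as [|n IH]; [easy|].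
  rewrite seq_S, lsum_app, <- IH; simpl; ring.
Qed.

Fixpoint tuples {I} (l : list I) (N : nat) : list (list I) :=
  match N with
  | O => [[]]
  | S M => flat_map (fun i => map (cons i) (tuples l M)) l
  end.

Lemma lsum_tuples_S {I} (l : list I) N F :
  lsum (tuples l (S N)) F = lsum l (fun i => lsum (tuples l N) (fun t => F (i :: t))).
Proof.
  simpl; generalize (tuples l N) as T; intros T.
  induction l as [|i l IH]; simpl; [easy|].
  now rewrite lsum_app, lsum_map, IH.
Qed.

Lemma rsum_tuples_S {I} (l : list I) N F :
  rsum (tuples l (S N)) F = rsum l (fun i => rsum (tuples l N) (fun t => F (i :: t))).
Proof.
  simpl; generalize (tuples l N) as T; intros T.
  induction l as [|i l IH]; simpl; [easy|].
  now rewrite rsum_app, rsum_map, IH.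
Qed.

Lemma in_tuples {I} (l : list I) N t :
  In t (tuples l N) -> length t = N /\ (forall i, In i t -> In i l).
Proof.
  revert t; induction N as [|N IH]; simpl; intros t H.
  { destruct H as [<- | []]; simpl; easy. }
  { apply in_flat_map in H as (i & Hi & H).
    apply in_map_iff in H as (s & <- & Hs).
    apply IH in Hs as [Hl Hs]; split; simpl; [lia|].
    intros j [<- | Hj]; auto. }
Qed.

(** A tuple of pairs amounts to a pair of tuples, [combine] being the bijection. *)
Lemma lsum_tuples_list_prod {I J} (l : list I) (l' : list J) N F :
  lsum (tuples (list_prod l l') N) F =
  lsum (tuples l N) (fun s => lsum (tuples l' N) (fun t => F (combine s t))).
Proof.
  revert F; induction N as [|N IH]; intros F.
  { simpl; ring. }
  { rewrite !lsum_tuples_S, lsum_list_prod.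
    apply lsum_ext; intros i _.
    rewrite (lsum_ext _ _ _ (fun j _ => IH (fun t => F ((i, j) :: t)))).
    rewrite lsum_swap; apply lsum_ext; intros s _.
    now rewrite lsum_tuples_S. }
Qed.

(** Distributivity: expanding the product of sums, [s] records which summand is taken from each
    factor. *)
Lemma lsum_tuples_lprod {I J} (l : list I) (t : list J) (g : I * J -> Cx) :
  lsum (tuples l (length t)) (fun s => lprod (combine s t) g) =
  lprod t (fun j => lsum l (fun i => g (i, j))).
Proof.
  induction t as [|j t IH]; simpl length.
  { simpl; ring. }
  { rewrite lsum_tuples_S; simpl; rewrite <- IH, <- lsum_mul_r.
    apply lsum_ext; intros i _; simpl; now rewrite lsum_mul_l. }
Qed.

(** * Positive definite kernels *)

Lemma lsum_seq_nth {I} (l : list I) (d : I) F :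
  lsum (seq 0 (length l)) (fun j => F (nth j l d)) = lsum l F.
Proof.
  induction l as [|i l IH]; simpl; [easy|].
  now rewrite <- seq_shift, lsum_map, IH.
Qed.

Lemma Cnonneg_C0 : Cnonneg C0.
Proof. split; simpl; lra. Qed.

Lemma Cnonneg_add a b : Cnonneg a -> Cnonneg b -> Cnonneg (a + b)%Cx.
Proof. intros [] []; split; simpl; lra. Qed.

(** Frees the quadratic form from its indexing by natural numbers, so that it can be tested on short
    explicit lists of points and coefficients and on products of index sets. *)
Lemma pd_lsum {X I} (k : X -> X -> Cx) (l : list I) (x : I -> X) (c : I -> Cx) :
  pos_def_kernel k ->
  Cnonneg (lsum l (fun s => lsum l (fun t => k (x s) (x t) * c s * Cconj (c t))%Cx)).
Proof.
  (* The index type may be empty; the head [d] serves as the default value of [nth]. *)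
  intros H; destruct l as [|d l']; [apply Cnonneg_C0|].
  set (l := d :: l').
  specialize (H (length l) (fun j => x (nth j l d)) (fun j => c (nth j l d))).
  rewrite csum_lsum in H.
  erewrite lsum_ext in H by (intros; apply csum_lsum).
  rewrite (lsum_seq_nth l d (fun s => lsum _ (fun j => k (x s) (x (nth j l d)) * c s *
    Cconj (c (nth j l d)))%Cx)) in H.
  erewrite lsum_ext in H; [exact H|].
  intros s _; exact (lsum_seq_nth l d (fun t => k (x s) (x t) * c s * Cconj (c t))%Cx).
Qed.

Lemma pd_diag {X} (k : X -> X -> Cx) x : pos_def_kernel k -> Cnonneg (k x x).
Proof.
  intros H; pose proof (pd_lsum k [RtoC 1] (fun _ => x) (fun c => c) H) as Hx.
  simpl in Hx; rewrite Cconj_RtoC in Hx.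
  replace (k x x) with (k x x * RtoC 1 * RtoC 1 + C0 + C0)%Cx by ring; exact Hx.
Qed.

(** The quadratic form is real: coefficients 1, 1 make the imaginary parts opposite, and
    coefficients 1, i make the real parts equal. *)
Lemma pd_herm {X} (k : X -> X -> Cx) x y : pos_def_kernel k -> k y x = Cconj (k x y).
Proof.
  intros H; destruct (pd_diag k x H) as [Hx _]; destruct (pd_diag k y H) as [Hy _].
  destruct (pd_lsum k [(x, RtoC 1); (y, RtoC 1)] fst snd H) as [H1 _].
  destruct (pd_lsum k [(x, RtoC 1); (y, (0, 1))] fst snd H) as [Hi _].
  simpl in *; apply Cx_eq; simpl; lra.
Qed.

Lemma pd_bound {X} (k : X -> X -> Cx) x y :
  pos_def_kernel k -> k x x = k y y -> Cmod (k x y) <= fst (k x x).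
Proof.
  intros H E; destruct (Req_dec (Cmod (k x y)) 0) as [-> | H0]; [apply (pd_diag k x H)|].
  pose proof (Cmod_ge_0 (k x y)) as Hp; pose proof (Cmod_sqr (k x y)) as Hs.
  destruct (pd_diag k x H) as [Hx _].
  set (m := Cmod (k x y)) in *.
  (* The second coefficient is minus the phase of [k x y]; the form then becomes twice the
     difference of [k x x] and [m]. *)
  destruct (pd_lsum k [(x, RtoC 1); (y, RtoC (- / m) * k x y)%Cx] fst snd H) as [_ H1].
  simpl in H1; rewrite (pd_herm k x y H), <- E in H1; simpl in H1.
  set (a := fst (k x y)) in *; set (b := snd (k x y)) in *; set (A := fst (k x x)) in *.
  rewrite Hx in H1.
  match type of H1 with 0 <= ?e =>
    assert (He : e = A - 2 * (a ^ 2 + b ^ 2) / m + A * ((a ^ 2 + b ^ 2) / m ^ 2))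
      by (field; lra)
  end.
  rewrite He, <- Hs in H1.
  replace (A - 2 * m ^ 2 / m + A * (m ^ 2 / m ^ 2)) with (2 * (A - m)) in H1 by (field; lra).
  lra.
Qed.

(* The coefficients [1, - t d, t d] with [d = k o u - k o v] and [t = 1 / D]. *)
Lemma pd_increment_bound {X} (k : X -> X -> Cx) o u v D :
  pos_def_kernel k -> k u u = k o o -> k v v = k o o -> 0 < D ->
  2 * (fst (k o o) - fst (k u v)) <= D ->
  Cmod (k o u - k o v)%Cx ^ 2 <= fst (k o o) * D.
Proof.
  intros H Eu Ev HD HuvD.
  destruct (pd_diag k o H) as [Ho _].
  set (d := (k o u - k o v)%Cx).
  destruct (pd_lsum k [(o, RtoC 1); (u, RtoC (- / D) * d)%Cx; (v, RtoC (/ D) * d)%Cx]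
    fst snd H) as [_ H1].
  simpl in H1.
  rewrite (pd_herm k o u H), (pd_herm k o v H), (pd_herm k u v H), Eu, Ev in H1.
  simpl in H1; rewrite Ho in H1.
  rewrite Cmod_sqr; unfold d; simpl.
  set (A := fst (k o o)) in *; set (p := fst (k u v)) in *; set (q := snd (k u v)) in *.
  set (a := fst (k o u)) in *; set (b := snd (k o u)) in *.
  set (a' := fst (k o v)) in *; set (b' := snd (k o v)) in *.
  set (Y := (a - a') ^ 2 + (b - b') ^ 2).
  match type of H1 with 0 <= ?e =>
    assert (He : e = A - 2 * Y / D + Y * (2 * (A - p)) / D ^ 2)
      by (unfold Y; field; lra)
  end.
  rewrite He in H1.
  clear He.
  assert (HY : 0 <= Y)
    by (pose proof (pow2_ge_0 (a - a')); pose proof (pow2_ge_0 (b - b')); unfold Y; lra).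
  (* Dividing by the positive bound [D] rather than by 2 (A - p) covers the case A = p. What remains
     of the form is A - Y / D. *)
  assert (H2 : Y * (2 * (A - p)) / D ^ 2 <= Y / D).
  { replace (Y / D) with (Y * D / D ^ 2) by (field; lra).
    apply Rmult_le_compat_r; [left; apply Rinv_0_lt_compat; nra | nra]. }
  assert (H3 : Y / D <= A) by (replace (2 * Y / D) with (2 * (Y / D)) in H1 by (field; lra); lra).
  change (Y <= A * D).
  replace Y with (Y / D * D) by (field; lra); nra.
Qed.

Lemma pd_ext {X} (k k' : X -> X -> Cx) :
  (forall x y, k x y = k' x y) -> pos_def_kernel k -> pos_def_kernel k'.
Proof.
  intros E H n x c; specialize (H n x c).
  rewrite csum_lsum in *.
  erewrite lsum_ext; [exact H|]; intros i _; simpl.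
  rewrite !csum_lsum; apply lsum_ext; intros; now rewrite E.
Qed.

Lemma pd_comap {X Y} (g : Y -> X) (k : X -> X -> Cx) :
  pos_def_kernel k -> pos_def_kernel (fun x y => k (g x) (g y)).
Proof. intros H n x c; exact (H n (fun j => g (x j)) c). Qed.

Lemma pd_0 {X} : pos_def_kernel (fun _ _ : X => C0).
Proof.
  intros n x c; rewrite csum_lsum, lsum_0; [apply Cnonneg_C0|].
  intros; rewrite csum_lsum, lsum_0; [easy|]; intros; ring.
Qed.

(* The Gram kernel of a Hilbert space valued map preserves positivity under products:
   the vectors are absorbed into the coefficients [c]. *)
Lemma pd_gram {X I} (k : X -> X -> Cx) (l : list I) (g : I -> X -> Cx) :
  pos_def_kernel k ->
  pos_def_kernel (fun x y => k x y * lsum l (fun i => g i x * Cconj (g i y)))%Cx.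
Proof.
  intros H n x c; induction l as [|i l IH].
  { refine (pd_ext (fun _ _ => C0) (fun y z => k y z * C0)%Cx _ pd_0 n x c).
    intros; ring. }
  { pose proof (Cnonneg_add _ _ (H n x (fun j => c j * g i (x j))%Cx) IH) as H1.
    rewrite !csum_lsum, <- lsum_add in H1.
    rewrite csum_lsum; erewrite lsum_ext; [exact H1|].
    intros j _; simpl; rewrite !csum_lsum, <- lsum_add; apply lsum_ext; intros m _.
    rewrite Cconj_mul; ring. }
Qed.

Lemma pd_add {X} (k k' : X -> X -> Cx) :
  pos_def_kernel k -> pos_def_kernel k' -> pos_def_kernel (fun x y => k x y + k' x y)%Cx.
Proof.
  intros H H' n x c; pose proof (Cnonneg_add _ _ (H n x c) (H' n x c)) as H1.
  rewrite !csum_lsum, <- lsum_add in H1.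
  rewrite csum_lsum; erewrite lsum_ext; [exact H1|].
  intros j _; simpl; rewrite !csum_lsum, <- lsum_add; apply lsum_ext; intros; ring.
Qed.

Lemma pd_lsum_kernel {X I} (l : list I) (k : I -> X -> X -> Cx) :
  (forall i, In i l -> pos_def_kernel (k i)) ->
  pos_def_kernel (fun x y => lsum l (fun i => k i x y)).
Proof.
  induction l as [|i l IH]; simpl; intros H; [apply pd_0|].
  apply (pd_add (k i)); auto.
Qed.

(** * Limits along an ultrafilter *)

(** An ultrafilter gives limits of all coefficients at all points of a possibly uncountable group at
    once, where extracting a diagonal subsequence would fail. By [uf_tail] it is not principal, so
    its limits extend ordinary ones. *)
Record ultrafilter (U : (nat -> Prop) -> Prop) : Prop := {
  uf_and : forall A B, U A -> U B -> U (fun n => A n /\ B n);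
  uf_mono : forall A B : nat -> Prop, (forall n, A n -> B n) -> U A -> U B;
  uf_nonempty : ~ U (fun _ => False);
  uf_dec : forall A, U A \/ U (fun n => ~ A n);
  uf_tail : forall N, U (fun n => (N <= n)%nat)
}.

Lemma ultrafilter_exists : exists U, ultrafilter U.
Proof.
  destruct (filter.ultraFilterLemma filter.eventually_filter) as (U & HU & Hsub).
  pose proof (filter.filter_filter (ProperFilter := filter.ultra_proper (UltraFilter := HU)))
    as HF.
  exists U; split.
  { intros A B; apply (filter.filterI (Filter := HF)). }
  { intros A B; apply (filter.filterS (Filter := HF)). }
  { apply (filter.filter_not_empty U). }
  { intros A; apply (filter.in_ultra_setVsetC A HU). }
  { intros N; apply Hsub; exists N; [exact I|].
    intros n; unfold classical_sets.mkset.
    destruct (@ssrnat.leP N n); [auto | discriminate]. }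
Qed.

Section UltraLimit.
Context {U : (nat -> Prop) -> Prop} (HU : ultrafilter U).

Definition ucv (x : nat -> Cx) (l : Cx) : Prop :=
  forall eps, 0 < eps -> U (fun n => Cmod (x n - l)%Cx < eps).

Lemma uf_eventually (A : nat -> Prop) N : (forall n, (N <= n)%nat -> A n) -> U A.
Proof. intros H; exact (uf_mono U HU _ _ H (uf_tail U HU N)). Qed.

Lemma uf_inhabited A : U A -> exists n, A n.
Proof.
  intros HA; apply NNPP; intros H; apply (uf_nonempty U HU).
  apply (uf_mono U HU A); [|exact HA]; intros n Hn; apply H; now exists n.
Qed.

Lemma ultra_limit_R (x : nat -> R) B :
  U (fun n => Rabs (x n) <= B) ->
  exists l, forall eps, 0 < eps -> U (fun n => Rabs (x n - l) < eps).
Proof.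
  intros HB.
  assert (Hin : U (fun n => - B <= x n <= B)).
  { apply (uf_mono U HU _ _) with (2 := HB); intros n; unfold Rabs; destruct Rcase_abs; lra. }
  (* The limit is the supremum of the [t] that lie below [x n] for [U]-almost all [n]. *)
  destruct (completeness (fun t => U (fun n => t <= x n))) as [l [Hub Hleast]].
  { exists B; intros t Ht; destruct (uf_inhabited _ (uf_and U HU _ _ Ht Hin)) as [n Hn]; lra. }
  { exists (- B); apply (uf_mono U HU _ _) with (2 := Hin); intros n Hn; lra. }
  exists l; intros eps Heps.
  destruct (uf_dec U HU (fun n => l + eps / 2 <= x n)) as [H1 | H1].
  { specialize (Hub _ H1); lra. }
  destruct (uf_dec U HU (fun n => l - eps / 2 <= x n)) as [H2 | H2].
  { apply (uf_mono U HU _ _) with (2 := uf_and U HU _ _ H1 H2).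
    intros n [Ha Hb]; apply Rabs_def1; lra. }
  exfalso.
  assert (l <= l - eps / 2); [|lra].
  apply Hleast; intros t Ht.
  destruct (Rle_dec t (l - eps / 2)) as [Hl | Hl]; [exact Hl | exfalso].
  destruct (uf_inhabited _ (uf_and U HU _ _ Ht H2)) as [n [Ha Hb]]; lra.
Qed.

Lemma Cmod_le_sum a : Cmod a <= Rabs (fst a) + Rabs (snd a).
Proof.
  pose proof (Rabs_pos (fst a)); pose proof (Rabs_pos (snd a)).
  apply Rsqr_incr_0_var; [rewrite !Rsqr_pow2 | lra].
  rewrite Cmod_sqr, <- (pow2_abs (fst a)), <- (pow2_abs (snd a)); nra.
Qed.

Lemma ultra_limit (x : nat -> Cx) B : U (fun n => Cmod (x n) <= B) -> exists l, ucv x l.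
Proof.
  intros HB.
  destruct (ultra_limit_R (fun n => fst (x n)) B) as [a Ha].
  { apply (uf_mono U HU _ _) with (2 := HB); intros n Hn.
    pose proof (fst_le_Cmod (x n)); lra. }
  destruct (ultra_limit_R (fun n => snd (x n)) B) as [b Hb].
  { apply (uf_mono U HU _ _) with (2 := HB); intros n Hn.
    pose proof (snd_le_Cmod (x n)); lra. }
  exists (a, b); intros eps Heps.
  apply (uf_mono U HU _ _)
    with (2 := uf_and U HU _ _ (Ha (eps / 2) ltac:(lra)) (Hb (eps / 2) ltac:(lra))).
  intros n [H1 H2]; pose proof (Cmod_le_sum (x n - (a, b))%Cx) as H3; simpl in H3.
  unfold Rminus in *; lra.
Qed.

Lemma ucv_of_cv x l : Cseq_cv x l -> ucv x l.
Proof.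
  intros H eps Heps; destruct (H eps Heps) as [N HN]; exact (uf_eventually _ N HN).
Qed.

Lemma ucv_const a : ucv (fun _ => a) a.
Proof.
  intros eps Heps; apply (uf_eventually _ 0); intros n _.
  replace (a - a)%Cx with C0 by ring; now rewrite Cmod_C0.
Qed.

Lemma ucv_add x y a b : ucv x a -> ucv y b -> ucv (fun n => x n + y n)%Cx (a + b)%Cx.
Proof.
  intros Hx Hy eps Heps.
  apply (uf_mono U HU _ _)
    with (2 := uf_and U HU _ _ (Hx (eps / 2) ltac:(lra)) (Hy (eps / 2) ltac:(lra))).
  intros n [H1 H2].
  replace (x n + y n - (a + b))%Cx with ((x n - a) + (y n - b))%Cx by ring.
  pose proof (Cmod_triangle (x n - a) (y n - b)); lra.
Qed.

Lemma ucv_mul_r x a c : ucv x a -> ucv (fun n => x n * c)%Cx (a * c)%Cx.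
Proof.
  intros Hx eps Heps; pose proof (Cmod_ge_0 c) as Hc.
  assert (Hq : 0 < eps / (Cmod c + 1)) by (apply Rdiv_lt_0_compat; lra).
  apply (uf_mono U HU _ _) with (2 := Hx _ Hq).
  intros n H1; simpl in H1.
  replace (x n * c - a * c)%Cx with ((x n - a) * c)%Cx by ring.
  rewrite Cmod_mul; pose proof (Cmod_ge_0 (x n - a)%Cx).
  apply Rle_lt_trans with (Cmod (x n - a)%Cx * (Cmod c + 1)); [nra|].
  replace eps with (eps / (Cmod c + 1) * (Cmod c + 1)) by (field; lra).
  apply Rmult_lt_compat_r; lra.
Qed.

Lemma ucv_sub x y a b : ucv x a -> ucv y b -> ucv (fun n => x n - y n)%Cx (a - b)%Cx.
Proof.
  intros Hx Hy.
  replace (a - b)%Cx with (a + b * RtoC (-1))%Cx by (apply Cx_eq; simpl; ring).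
  intros eps Heps.
  apply (uf_mono U HU _ _) with (2 := ucv_add _ _ _ _ Hx (ucv_mul_r _ _ (RtoC (-1)) Hy) eps Heps).
  intros n H; replace (x n - y n)%Cx with (x n + y n * RtoC (-1))%Cx
    by (apply Cx_eq; simpl; ring); exact H.
Qed.

Lemma ucv_lsum {I} (l : list I) (x : nat -> I -> Cx) (a : I -> Cx) :
  (forall i, In i l -> ucv (fun n => x n i) (a i)) ->
  ucv (fun n => lsum l (x n)) (lsum l a).
Proof.
  induction l as [|i l IH]; simpl; intros H; [apply ucv_const|].
  apply ucv_add; auto.
Qed.

Lemma ucv_Cmod_le x a B : ucv x a -> U (fun n => Cmod (x n) <= B) -> Cmod a <= B.
Proof.
  intros Hx HB; apply le_epsilon; intros eps Heps.
  destruct (uf_inhabited _ (uf_and U HU _ _ (Hx eps Heps) HB)) as [n [H1 H2]].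
  rewrite Cmod_sub_sym in H1.
  pose proof (Cmod_triangle (a - x n) (x n)) as H3.
  replace (a - x n + x n)%Cx with a in H3 by ring; lra.
Qed.

Lemma ucv_Cnonneg x a : U (fun n => Cnonneg (x n)) -> ucv x a -> Cnonneg a.
Proof.
  intros Hp Hx.
  assert (Hclose : forall eps, 0 < eps -> Rabs (snd a) <= eps /\ - eps <= fst a).
  { intros eps Heps.
    destruct (uf_inhabited _ (uf_and U HU _ _ (Hx eps Heps) Hp)) as [n [Hn [H1 H2]]].
    pose proof (fst_le_Cmod (x n - a)%Cx) as H3; pose proof (snd_le_Cmod (x n - a)%Cx) as H4.
    simpl in H3, H4; rewrite H1 in H4.
    replace (0 - snd a) with (- snd a) in H4 by ring; rewrite Rabs_Ropp in H4; split; [lra|].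
    revert H3; unfold Rabs; destruct Rcase_abs; lra. }
  split.
  { destruct (Req_dec (snd a) 0) as [E | E]; [exact E|].
    apply Rabs_pos_lt in E; destruct (Hclose (Rabs (snd a) / 2)); lra. }
  { destruct (Rle_dec 0 (fst a)) as [E | E]; [exact E|].
    destruct (Hclose (- fst a / 2)); lra. }
Qed.

(** Each positivity condition involves finitely many values of the kernel, so it survives pointwise
    limits. *)
Lemma ucv_pd {X} (k : nat -> X -> X -> Cx) (k' : X -> X -> Cx) :
  U (fun n => pos_def_kernel (k n)) ->
  (forall x y, ucv (fun n => k n x y) (k' x y)) -> pos_def_kernel k'.
Proof.
  intros Hk Hl n x c; rewrite csum_lsum.
  apply ucv_Cnonneg with (x := fun N => csum n (fun j => csum n (fun l =>
    k N (x j) (x l) * c j * Cconj (c l))%Cx)).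
  { apply (uf_mono U HU _ _) with (2 := Hk); intros N HN; apply HN. }
  intros eps Heps.
  assert (H : ucv (fun N => lsum (seq 0 n) (fun j => lsum (seq 0 n) (fun l =>
    k N (x j) (x l) * c j * Cconj (c l))%Cx)) (lsum (seq 0 n) (fun j => csum n (fun l =>
    k' (x j) (x l) * c j * Cconj (c l))%Cx))).
  { apply ucv_lsum; intros j _; rewrite csum_lsum; apply ucv_lsum; intros l _.
    apply ucv_mul_r, ucv_mul_r, Hl. }
  apply (uf_mono U HU _ _) with (2 := H eps Heps).
  intros N HN; rewrite csum_lsum.
  erewrite (lsum_ext (seq 0 n)); [exact HN|]; intros; apply csum_lsum.
Qed.

End UltraLimit.

(** * Fourier analysis on the roots of unity *)

(** On the unit circle this is the character of frequency [fst j - snd j]. Inside the disc the two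
    exponents matter separately. *)
Definition mono (z : Cx) (j : nat * nat) : Cx := (Cpow z (fst j) * Cpow (Cconj z) (snd j))%Cx.

Lemma mono_mul a b j : mono (a * b) j = (mono a j * mono b j)%Cx.
Proof. unfold mono; rewrite Cconj_mul, !Cpow_mul; ring. Qed.

Lemma mono_conj a j : mono (Cconj a) j = Cconj (mono a j).
Proof. unfold mono; rewrite Cconj_mul, !Cpow_conj, Cconj_conj; ring. Qed.

Lemma Cmod_mono z j : Cmod (mono z j) = Cmod z ^ (fst j + snd j).
Proof. unfold mono; now rewrite Cmod_mul, !Cmod_pow, Cmod_conj, pow_add. Qed.

Lemma mono_RtoC r j : mono (RtoC r) j = RtoC (r ^ (fst j + snd j)).
Proof. unfold mono; now rewrite Cconj_RtoC, !Cpow_RtoC, <- RtoC_mul, pow_add. Qed.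

Lemma mono_add z m n m' n' : mono z (m + m', n + n')%nat = (mono z (m, n) * mono z (m', n'))%Cx.
Proof. unfold mono; simpl; rewrite !Cpow_add; ring. Qed.

Lemma mono_swap z m n : mono (Cconj z) (m, n) = mono z (n, m).
Proof. unfold mono; simpl; rewrite Cconj_conj; ring. Qed.

Lemma mono_lprod z (k : list (nat * nat)) :
  lprod k (mono z) = mono z (list_sum (map fst k), list_sum (map snd k)).
Proof.
  induction k as [|[m n] k IH]; simpl; [unfold mono; simpl; ring|].
  now rewrite mono_add, IH.
Qed.

Definition cis (t : R) : Cx := (cos t, sin t).

Lemma cis_add s t : cis (s + t) = (cis s * cis t)%Cx.
Proof. apply Cx_eq; simpl; [apply cos_plus | rewrite sin_plus; ring]. Qed.

Lemma cis_0 : cis 0 = RtoC 1.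
Proof. apply Cx_eq; simpl; [apply cos_0 | apply sin_0]. Qed.

Lemma cis_conj t : Cconj (cis t) = cis (- t).
Proof. apply Cx_eq; simpl; [now rewrite cos_neg | now rewrite sin_neg]. Qed.

Lemma Cmod_cis t : Cmod (cis t) = 1.
Proof.
  pose proof (sin2_cos2 t) as H; unfold Rsqr in H.
  unfold Cmod; simpl; replace (_ + _) with 1 by lra; apply sqrt_1.
Qed.

Lemma cis_pow t n : Cpow (cis t) n = cis (INR n * t).
Proof.
  induction n as [|n IH]; [simpl; now rewrite Rmult_0_l, cis_0|].
  rewrite S_INR; simpl; rewrite IH, <- cis_add; f_equal; ring.
Qed.

Lemma mono_cis t m n : mono (cis t) (m, n) = cis ((INR m - INR n) * t).
Proof. unfold mono; simpl; rewrite cis_conj, !cis_pow, <- cis_add; f_equal; ring. Qed.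

Lemma cis_neq_1 t : t <> 0 -> - (2 * PI) < t < 2 * PI -> cis t <> RtoC 1.
Proof.
  intros H0 Ht E; apply (f_equal fst) in E; simpl in E.
  replace t with (2 * (t / 2)) in E by field; rewrite cos_2a_sin in E.
  assert (Hs : sin (t / 2) <> 0); [|nra].
  destruct (Rlt_dec 0 t) as [Hp | Hn].
  { pose proof (sin_gt_0 (t / 2)); lra. }
  { pose proof (sin_gt_0 (- (t / 2))) as H; rewrite sin_neg in H; lra. }
Qed.

Lemma lsum_geom q n :
  (lsum (seq 0 n) (Cpow q) * (RtoC 1 - q))%Cx = (RtoC 1 - Cpow q n)%Cx.
Proof.
  rewrite <- csum_lsum; induction n as [|n IH]; simpl; [ring|].
  replace ((csum n (Cpow q) + Cpow q n) * (RtoC 1 - q))%Cx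
    with (csum n (Cpow q) * (RtoC 1 - q) + Cpow q n * (RtoC 1 - q))%Cx by ring.
  rewrite IH; ring.
Qed.

Lemma Cmul_eq_0 a b : (a * b)%Cx = C0 -> b <> C0 -> a = C0.
Proof.
  intros H Hb; destruct (Req_dec (Cmod a) 0) as [E | E]; [exact (Complex.Cmod_eq_0 a E)|].
  exfalso; apply Hb, (Complex.Cmod_eq_0 b).
  apply (f_equal Cmod) in H; rewrite Cmod_mul, Cmod_C0 in H.
  apply Rmult_integral in H; tauto.
Qed.

Definition root (p a : nat) : Cx := cis (2 * PI * INR a / INR p).

Lemma mono_root p a m n :
  mono (root p a) (m, n) = Cpow (cis ((INR m - INR n) * (2 * PI / INR p))) a.
Proof. unfold root; rewrite mono_cis, cis_pow; f_equal; unfold Rdiv; ring. Qed.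

(** A geometric sum whose ratio [q] satisfies q^p = 1, while q differs from 1 because 0 < |m - n| <
    p. *)
Lemma lsum_mono_root p m n :
  (m < p)%nat -> (n < p)%nat -> m <> n -> lsum (seq 0 p) (fun a => mono (root p a) (m, n)) = C0.
Proof.
  intros Hm Hn Hmn.
  assert (Hp : 0 < INR p) by (apply lt_0_INR; lia).
  rewrite (lsum_ext _ _ _ (fun a _ => mono_root p a m n)).
  set (q := cis _); apply Cmul_eq_0 with (RtoC 1 - q)%Cx.
  { rewrite lsum_geom; unfold q; rewrite cis_pow.
    replace (INR p * _) with ((INR m - INR n) * (2 * PI)) by (field; lra).
    rewrite <- mono_cis; replace (cis (2 * PI)) with (RtoC 1).
    { rewrite mono_RtoC, pow1; ring. }
    apply Cx_eq; simpl; [now rewrite cos_2PI | now rewrite sin_2PI]. }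
  { intros E; assert (Hq : q <> RtoC 1).
    { pose proof PI_RGT_0; pose proof (pos_INR m); pose proof (pos_INR n).
      assert (INR m < INR p) by (now apply lt_INR); assert (INR n < INR p) by (now apply lt_INR).
      assert (Hd : INR m - INR n <> 0) by (apply Rminus_eq_contra, not_INR, Hmn).
      assert (Hs : 0 < 2 * PI / INR p) by (apply Rdiv_lt_0_compat; lra).
      assert (Hs2 : INR p * (2 * PI / INR p) = 2 * PI) by (field; lra).
      apply cis_neq_1; [|split; nra].
      intros E'; apply Rmult_integral in E'; lra. }
    apply Hq; replace q with (RtoC 1 - (RtoC 1 - q))%Cx by ring; rewrite E; ring. }
Qed.

(* [(k, 0)] stands for the character [x -> x^k] of the group of roots of unity of order
   [2 h + 1], and [(0, k)] for its conjugate. *)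
Definition dual (h : nat) : list (nat * nat) :=
  map (fun k => (k, O)) (seq 0 (S h)) ++ map (fun k => (O, k)) (seq 1 h).

Lemma in_dual h j :
  In j (dual h) -> (fst j <= h /\ snd j <= h /\ (fst j = 0 \/ snd j = 0))%nat.
Proof.
  intros H; apply in_app_or in H.
  destruct H as [H | H]; apply in_map_iff in H as (k & <- & Hk); apply in_seq in Hk; simpl; lia.
Qed.

Lemma NoDup_dual h : NoDup (dual h).
Proof.
  apply NoDup_app.
  { apply NoDup_map_NoDup_ForallPairs; [|apply seq_NoDup]; intros ? ? _ _ [=]; auto. }
  { apply NoDup_map_NoDup_ForallPairs; [|apply seq_NoDup]; intros ? ? _ _ [=]; auto. }
  { intros j H H'; apply in_map_iff in H as (k & <- & _).
    apply in_map_iff in H' as (k' & E & Hk'); apply in_seq in Hk'; injection E; lia. }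
Qed.

Lemma lsum_single {I} (l : list I) F i :
  NoDup l -> In i l -> (forall j, In j l -> j <> i -> F j = C0) -> lsum l F = F i.
Proof.
  induction l as [|j l IH]; intros Hnd Hi H0; [easy|].
  apply NoDup_cons_iff in Hnd as [Hj Hnd]; simpl.
  destruct Hi as [-> | Hi].
  { rewrite lsum_0; [ring|].
    intros j Hl; apply H0; [now right | intros ->; easy]. }
  { rewrite H0, IH; auto; [ring | | now left | intros ->; easy].
    intros; apply H0; [now right | easy]. }
Qed.

(** The normalised conjugate character: summing against it over the roots of unity extracts the
    Fourier coefficient at [j]. *)
Definition psi (p : nat) (j : nat * nat) (a : nat) : Cx :=
  (RtoC (/ INR p) * mono (Cconj (root p a)) j)%Cx.

Lemma lsum_const {I} (l : list I) c : lsum l (fun _ => c) = (RtoC (INR (length l)) * c)%Cx.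
Proof.
  induction l as [|i l IH]; [simpl; apply Cx_eq; simpl; ring|].
  simpl length; rewrite S_INR, RtoC_add; simpl; rewrite IH; ring.
Qed.

(** The test compares the frequencies [fst - snd] without subtraction. All exponents that arise are
    at most 2 h, below the order 2 h + 1 of the group, so distinct frequencies stay distinct modulo
    that order. *)
Lemma psi_orthogonal h j s :
  In j (dual h) -> In s (dual h) ->
  lsum (seq 0 (2 * h + 1)) (fun a => psi (2 * h + 1) j a * mono (root (2 * h + 1) a) s)%Cx =
  if (Nat.eq_dec (fst j + snd s) (fst s + snd j)) then RtoC 1 else C0.
Proof.
  intros Hj Hs; set (p := (2 * h + 1)%nat).
  assert (Hp : 0 < INR p) by (apply lt_0_INR; lia).
  apply in_dual in Hj; apply in_dual in Hs.
  destruct j as [j1 j2], s as [s1 s2]; simpl in Hj, Hs; simpl fst; simpl snd.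
  rewrite (lsum_ext _ _ (fun a => RtoC (/ INR p) * mono (root p a) (s1 + j2, j1 + s2)%nat)%Cx).
  2:{ intros a _; unfold psi; rewrite mono_swap, (Nat.add_comm j1), mono_add; ring. }
  rewrite lsum_mul_l; destruct (Nat.eq_dec _ _) as [E | E].
  { rewrite E, (lsum_ext _ _ (fun _ => RtoC 1)).
    { rewrite lsum_const, length_seq.
      replace (RtoC (/ INR p) * (RtoC (INR p) * RtoC 1))%Cx with (RtoC (/ INR p * INR p))
        by (rewrite RtoC_mul; ring).
      now rewrite Rinv_l by lra. }
    intros a _; unfold root; rewrite mono_cis, Rminus_diag, Rmult_0_l; apply cis_0. }
  { rewrite lsum_mono_root; [ring | lia..]. }
Qed.

Lemma dual_eq h j s :
  In j (dual h) -> In s (dual h) -> (fst j + snd s = fst s + snd j)%nat -> j = s.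
Proof.
  intros Hj Hs E; apply in_dual in Hj; apply in_dual in Hs.
  destruct j, s; simpl in *; f_equal; lia.
Qed.

(* The joint weight of a pair of roots of unity whose quotient has mean [z]: a Poisson kernel
   truncated to the frequencies resolved by the group. *)
Definition weight (h : nat) (z : Cx) (t : nat * nat) : Cx :=
  lsum (dual h) (fun j => mono z j *
    (psi (2 * h + 1) j (fst t) * Cconj (psi (2 * h + 1) j (snd t))))%Cx.

(** The contribution of one coordinate to the hermitian product of two torus vectors, before
    scaling. *)
Definition quot (p : nat) (t : nat * nat) : Cx := (root p (fst t) * Cconj (root p (snd t)))%Cx.

Definition grid (h : nat) : list (nat * nat) :=
  list_prod (seq 0 (2 * h + 1)) (seq 0 (2 * h + 1)).

(** The quotient has the moments of the Poisson kernel: the sums over the two roots separate into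
    [G j] and its conjugate, and orthogonality leaves only the term [j = s]. *)
Lemma weight_moment h z s :
  In s (dual h) ->
  lsum (grid h) (fun t => weight h z t * mono (quot (2 * h + 1) t) s)%Cx = mono z s.
Proof.
  intros Hs; unfold grid; rewrite lsum_list_prod; set (p := (2 * h + 1)%nat).
  set (G := fun j => lsum (seq 0 p) (fun a => psi p j a * mono (root p a) s)%Cx).
  transitivity (lsum (dual h) (fun j => mono z j * (G j * Cconj (G j)))%Cx).
  { rewrite (lsum_ext _ _ (fun a => lsum (dual h) (fun j =>
      mono z j * Cconj (G j) * (psi p j a * mono (root p a) s))%Cx)).
    { rewrite lsum_swap; apply lsum_ext; intros j _.
      rewrite lsum_mul_l; fold (G j); ring. }
    intros a _; unfold weight; simpl fst; simpl snd; fold p.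
    rewrite (lsum_ext _ _ (fun b => lsum (dual h) (fun j => mono z j *
      (psi p j a * mono (root p a) s) * Cconj (psi p j b * mono (root p b) s)))%Cx).
    { rewrite lsum_swap; apply lsum_ext; intros j _.
      rewrite lsum_mul_l; unfold G; rewrite lsum_conj; ring. }
    intros b _; rewrite <- lsum_mul_r; apply lsum_ext; intros j _.
    unfold quot; simpl fst; simpl snd; rewrite mono_mul, mono_conj, Cconj_mul; ring. }
  rewrite (lsum_single _ _ s (NoDup_dual h) Hs).
  { unfold G, p; rewrite psi_orthogonal by easy.
    destruct (Nat.eq_dec _ _); [rewrite Cconj_RtoC; ring | lia]. }
  intros j Hj Hjs; unfold G, p; rewrite psi_orthogonal by easy.
  destruct (Nat.eq_dec _ _) as [E | E]; [|ring].
  now destruct Hjs; apply (dual_eq h).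
Qed.

(** The sum is 2 Re T - 1 with T = (1 - z^(h+1)) / (1 - z). Multiplied by |1 - z|^2 it is the
    Poisson numerator 1 - |z|^2 up to a truncation error of at most 6 |z|^(h+1). *)
Lemma dual_kernel_ge_0 h z :
  Cmod z < 1 -> 6 * Cmod z ^ S h <= 1 - Cmod z ^ 2 -> Cnonneg (lsum (dual h) (mono z)).
Proof.
  intros Hz Hh; unfold dual; rewrite lsum_app, !lsum_map.
  set (T := lsum (seq 0 (S h)) (Cpow z)).
  rewrite (lsum_ext _ _ (Cpow z)) by (intros; unfold mono; simpl; ring); fold T.
  replace (lsum (seq 1 h) _) with (Cconj T - RtoC 1)%Cx.
  2:{ unfold T; rewrite lsum_conj; simpl seq; simpl; rewrite Cconj_RtoC.
      rewrite (lsum_ext (seq 1 h) (fun i => mono z (O, i)) (fun i => Cconj (Cpow z i))).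
      { unfold lsum; ring. }
      intros; unfold mono; simpl; rewrite Cpow_conj; ring. }
  pose proof (lsum_geom z (S h)) as Hg; fold T in Hg.
  pose proof (Cmod_pow z (S h)) as Hw.
  pose proof (fst_le_Cmod (Cpow z (S h))) as Hc; pose proof (snd_le_Cmod (Cpow z (S h))) as Hd.
  pose proof (fst_le_Cmod z) as Ha; pose proof (snd_le_Cmod z) as Hb.
  rewrite Hw in Hc, Hd; rewrite Cmod_sqr in Hh.
  pose proof (f_equal fst Hg) as G1; pose proof (f_equal snd Hg) as G2.
  cbn [fst snd Cmul Csub RtoC] in G1, G2.
  set (w := Cmod z ^ S h) in *; set (c := fst (Cpow z (S h))) in *.
  set (d := snd (Cpow z (S h))) in *; set (a := fst z) in *; set (b := snd z) in *.
  set (x := fst T) in *; set (y := snd T) in *.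
  assert (Hc' : - w <= c <= w) by (revert Hc; unfold Rabs; destruct Rcase_abs; lra).
  assert (Hd' : - w <= d <= w) by (revert Hd; unfold Rabs; destruct Rcase_abs; lra).
  assert (Ha' : -1 < a < 1) by (revert Ha; unfold Rabs; destruct Rcase_abs; lra).
  assert (Hb' : -1 < b < 1) by (revert Hb; unfold Rabs; destruct Rcase_abs; lra).
  split; cbn [fst snd Cadd Csub Cconj RtoC]; fold x y; [ring|].
  assert (Hx : (2 * x - 1) * ((1 - a) ^ 2 + b ^ 2) =
    1 - a ^ 2 - b ^ 2 - 2 * c * (1 - a) + 2 * b * d).
  { replace ((2 * x - 1) * ((1 - a) ^ 2 + b ^ 2)) with
      (2 * ((1 - a) * (x * (1 - a) - y * (0 - b)) - b * (x * (0 - b) + y * (1 - a)))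
       - (1 - a) ^ 2 - b ^ 2) by ring.
    rewrite G1, G2; ring. }
  (* The constant 6 is 4 + 2: the two error terms cost at most 4 w and 2 w. *)
  assert (H1 : c * (1 - a) <= 2 * w) by nra.
  assert (H2 : - w <= b * d) by nra.
  assert (H3 : 0 <= (2 * x - 1) * ((1 - a) ^ 2 + b ^ 2)) by (rewrite Hx; lra).
  assert (H4 : 0 < (1 - a) ^ 2 + b ^ 2)
    by (pose proof (pow2_ge_0 b); assert (0 < (1 - a) ^ 2) by (apply pow_lt; lra); lra).
  assert (0 <= 2 * x - 1); [|lra].
  apply Rmult_le_reg_r with (1 := H4); lra.
Qed.

Lemma weight_ge_0 h z t :
  Cmod z < 1 -> 6 * Cmod z ^ S h <= 1 - Cmod z ^ 2 -> Cnonneg (weight h z t).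
Proof.
  intros Hz Hh; set (p := (2 * h + 1)%nat).
  (* Characters are multiplicative, so the weight is the truncated Poisson kernel at [y], divided by
     p^2; rotation keeps the modulus of [z]. *)
  set (y := (z * Cconj (quot p t))%Cx).
  assert (Hy : Cmod y = Cmod z).
  { unfold y, quot, root; rewrite Cmod_mul, Cmod_conj, Cmod_mul, Cmod_conj, !Cmod_cis; ring. }
  assert (E : weight h z t = (RtoC (/ INR p * / INR p) * lsum (dual h) (mono y))%Cx).
  { unfold weight; rewrite <- lsum_mul_l; apply lsum_ext; intros j _; fold p.
    unfold psi, y, quot; rewrite mono_mul, !Cconj_mul, !mono_mul, Cconj_conj, !mono_conj.
    rewrite Cconj_conj, Cconj_RtoC, RtoC_mul; ring. }
  rewrite <- Hy in Hz, Hh; destruct (dual_kernel_ge_0 h y Hz Hh) as [H1 H2].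
  rewrite E; split; cbn [fst snd Cmul RtoC]; rewrite H1; [ring|].
  assert (0 <= / INR p) by (apply Rlt_le, Rinv_0_lt_compat, lt_0_INR; lia).
  assert (0 <= / INR p * / INR p) by nra; nra.
Qed.

(** * A law of large numbers *)

Definition rprod {I} (l : list I) (w : I -> R) : R := fold_right (fun i s => w i * s) 1 l.

Lemma RtoC_rprod {I} (l : list I) w : RtoC (rprod l w) = lprod l (fun i => RtoC (w i)).
Proof. induction l as [|i l IH]; simpl; [easy | now rewrite RtoC_mul, IH]. Qed.

Lemma rprod_ge_0 {I} (l : list I) w : (forall i, In i l -> 0 <= w i) -> 0 <= rprod l w.
Proof.
  induction l as [|i l IH]; simpl; intros H; [lra|].
  assert (0 <= w i) by auto; assert (0 <= rprod l w) by auto; nra.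
Qed.

Section LargeNumbers.
Context {A : Type} (l : list A) (w : A -> R).
Hypothesis w_ge_0 : forall a, In a l -> 0 <= w a.
Hypothesis w_sum : rsum l w = 1.

(** Expectation over [N] independent draws of law [w]. *)
Definition expect N (F : list A -> R) : R := rsum (tuples l N) (fun t => rprod t w * F t).

Lemma expect_S N F : expect (S N) F = rsum l (fun a => w a * expect N (fun t => F (a :: t))).
Proof.
  unfold expect; rewrite rsum_tuples_S; apply rsum_ext; intros a _.
  rewrite <- rsum_mul_l; apply rsum_ext; intros t _; simpl; ring.
Qed.

Lemma expect_ext N F G :
  (forall t, In t (tuples l N) -> F t = G t) -> expect N F = expect N G.
Proof. intros H; apply rsum_ext; intros t Ht; now rewrite H. Qed.

Lemma expect_le N F G :
  (forall t, In t (tuples l N) -> F t <= G t) -> expect N F <= expect N G.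
Proof.
  intros H; apply rsum_le; intros t Ht; apply Rmult_le_compat_l; [|auto].
  apply rprod_ge_0; intros a Ha; now apply w_ge_0, (in_tuples _ _ _ Ht).
Qed.

Lemma expect_add N F G : expect N (fun t => F t + G t) = expect N F + expect N G.
Proof.
  unfold expect; rewrite <- rsum_add; apply rsum_ext; intros; ring.
Qed.

Lemma expect_mul_l N c F : expect N (fun t => c * F t) = c * expect N F.
Proof.
  unfold expect; rewrite <- rsum_mul_l; apply rsum_ext; intros; ring.
Qed.

Lemma expect_1 N : expect N (fun _ => 1) = 1.
Proof.
  induction N as [|N IH]; [unfold expect; simpl; ring|].
  rewrite expect_S, IH, <- w_sum; apply rsum_ext; intros; rewrite w_sum; ring.
Qed.

Lemma expect_const N c : expect N (fun _ => c) = c.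
Proof.
  transitivity (expect N (fun _ => c * 1)); [apply expect_ext; intros; ring|].
  rewrite (expect_mul_l N c (fun _ => 1)), expect_1; ring.
Qed.

Lemma expect_sum N (X : A -> R) :
  rsum l (fun a => w a * X a) = 0 -> expect N (fun t => rsum t X) = 0.
Proof.
  intros H; induction N as [|N IH]; [unfold expect; simpl; ring|].
  rewrite expect_S, <- H; apply rsum_ext; intros a _; simpl.
  rewrite (expect_add N (fun _ => X a)), expect_const, IH; ring.
Qed.

(** Additivity of the variance: independence and centring kill the cross terms. *)
Lemma expect_sum_sqr N (X : A -> R) C :
  rsum l (fun a => w a * X a) = 0 -> (forall a, In a l -> X a ^ 2 <= C) ->
  expect N (fun t => rsum t X ^ 2) <= INR N * C.
Proof.
  intros H HC; induction N as [|N IH]; [unfold expect; simpl; lra|].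
  rewrite expect_S, S_INR.
  apply Rle_trans with (rsum l (fun a => w a * ((INR N + 1) * C))).
  { apply rsum_le; intros a Ha; apply Rmult_le_compat_l; [auto|]; simpl.
    rewrite (expect_ext N _ (fun t => (X a ^ 2 + (2 * X a) * rsum t X) + rsum t X ^ 2))
      by (intros; ring).
    rewrite !expect_add, expect_const, (expect_mul_l N), (expect_sum N X H).
    specialize (HC a Ha); lra. }
  { rewrite (rsum_ext _ _ (fun a => ((INR N + 1) * C) * w a)) by (intros; ring).
    rewrite rsum_mul_l, w_sum; lra. }
Qed.

Definition mean (Y : A -> Cx) (t : list A) : Cx := (RtoC (/ INR (length t)) * lsum t Y)%Cx.

Lemma mean_in_disc (Y : A -> Cx) t : (forall a, in_disc (Y a)) -> in_disc (mean Y t).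
Proof.
  intros HY; unfold in_disc, mean; rewrite Cmod_mul.
  assert (HS : Cmod (lsum t Y) <= INR (length t)).
  { induction t as [|a t IH]; [simpl; rewrite Cmod_C0; lra|].
    simpl length; rewrite S_INR; simpl.
    pose proof (Cmod_triangle (Y a) (lsum t Y)); pose proof (HY a); unfold in_disc in *; lra. }
  destruct t as [|a t]; [simpl; rewrite Cmod_C0; lra|].
  set (n := INR (length (a :: t))) in *.
  assert (Hn : 0 < n) by (apply lt_0_INR; simpl; lia).
  assert (Hi : 0 < / n) by (now apply Rinv_0_lt_compat).
  rewrite Cmod_RtoC_pos by lra.
  apply (Rmult_le_compat_l (/ n)) in HS; [rewrite Rinv_l in HS|]; lra.
Qed.

Lemma Cmod_expect_le N (g : list A -> Cx) B :
  (forall t, In t (tuples l N) -> Cmod (g t) <= B) ->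
  Cmod (lsum (tuples l N) (fun t => RtoC (rprod t w) * g t)%Cx) <= B.
Proof.
  intros HB; eapply Rle_trans; [apply Cmod_lsum|].
  rewrite <- (expect_const N B).
  eapply Rle_trans; [|apply expect_le, HB]; unfold expect.
  apply rsum_le; intros t Ht; rewrite Cmod_mul, Cmod_RtoC_pos; [lra|].
  apply rprod_ge_0; intros a Ha; now apply w_ge_0, (in_tuples _ _ _ Ht).
Qed.

(** Chebyshev's argument. Within [delta] of [z] the error is at most [eps]; farther away it is at
    most 2 B, hence at most M |mean - z|^2 with M = 2 B / delta^2. The real and imaginary parts of
    [Y - z] are centred with squares at most 4, so |mean - z|^2 has expectation at most 8 / N. *)
Lemma large_numbers N (Y : A -> Cx) z (g : Cx -> Cx) B eps delta :
  (0 < N)%nat -> lsum l (fun a => RtoC (w a) * Y a)%Cx = z ->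
  (forall a, in_disc (Y a)) -> in_disc z -> 0 < delta -> 0 <= eps ->
  (forall y, in_disc y -> Cmod (g y) <= B) ->
  (forall y, in_disc y -> Cmod (y - z)%Cx < delta -> Cmod (g y - g z)%Cx <= eps) ->
  Cmod (lsum (tuples l N) (fun t => RtoC (rprod t w) * g (mean Y t)) - g z)%Cx
    <= eps + 16 * B / (INR N * delta ^ 2).
Proof.
  intros HN Hz HY Hzd Hdelta Heps HB Hg.
  assert (HNR : 0 < INR N) by (now apply lt_0_INR).
  assert (HB0 : 0 <= B) by (specialize (HB z Hzd); pose proof (Cmod_ge_0 (g z)); lra).
  set (M := 2 * B / delta ^ 2).
  assert (HM : 0 <= M) by (apply Rle_mult_inv_pos; [lra | apply pow_lt; lra]).
  set (X1 := fun a => fst (Y a) - fst z); set (X2 := fun a => snd (Y a) - snd z).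
  assert (E1 : rsum l (fun a => w a * X1 a) = 0).
  { apply (f_equal fst) in Hz; rewrite lsum_fst in Hz; simpl in Hz.
    rewrite (rsum_ext _ _ (fun a => (w a * fst (Y a) - 0 * snd (Y a)) - fst z * w a))
      by (intros; unfold X1; ring).
    rewrite rsum_sub, rsum_mul_l, Hz, w_sum; ring. }
  assert (E2 : rsum l (fun a => w a * X2 a) = 0).
  { apply (f_equal snd) in Hz; rewrite lsum_snd in Hz; simpl in Hz.
    rewrite (rsum_ext _ _ (fun a => (w a * snd (Y a) + 0 * fst (Y a)) - snd z * w a))
      by (intros; unfold X2; ring).
    rewrite rsum_sub, rsum_mul_l, Hz, w_sum; ring. }
  assert (HX : forall u v, Rabs u <= 1 -> Rabs v <= 1 -> (u - v) ^ 2 <= 4).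
  { intros u v; unfold Rabs; do 2 destruct Rcase_abs; nra. }
  assert (HX1 : forall a, In a l -> X1 a ^ 2 <= 4).
  { intros a _; apply HX; eapply Rle_trans; try apply fst_le_Cmod; [apply HY | apply Hzd]. }
  assert (HX2 : forall a, In a l -> X2 a ^ 2 <= 4).
  { intros a _; apply HX; eapply Rle_trans; try apply snd_le_Cmod; [apply HY | apply Hzd]. }
  assert (Hconst : (g z = lsum (tuples l N) (fun t => RtoC (rprod t w) * g z))%Cx).
  { rewrite lsum_mul_r, <- RtoC_rsum.
    rewrite (rsum_ext _ _ (fun t => rprod t w * 1)) by (intros; ring).
    fold (expect N (fun _ => 1)); rewrite expect_1; ring. }
  rewrite Hconst at 1; rewrite <- lsum_sub.
  eapply Rle_trans; [apply Cmod_lsum|].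
  apply Rle_trans with (expect N (fun t =>
    eps + M * / INR N ^ 2 * (rsum t X1 ^ 2 + rsum t X2 ^ 2))).
  { apply rsum_le; intros t Ht.
    replace (RtoC (rprod t w) * g (mean Y t) - RtoC (rprod t w) * g z)%Cx
      with (RtoC (rprod t w) * (g (mean Y t) - g z))%Cx by ring.
    assert (Hw : 0 <= rprod t w)
      by (apply rprod_ge_0; intros a Ha; now apply w_ge_0, (in_tuples _ _ _ Ht)).
    rewrite Cmod_mul, Cmod_RtoC_pos by easy; apply Rmult_le_compat_l; [easy|].
    assert (Hd : Cmod (mean Y t - z)%Cx ^ 2 = / INR N ^ 2 * (rsum t X1 ^ 2 + rsum t X2 ^ 2)).
    { assert (Hmean : forall (P : Cx -> R) (zP : R) s,
        / INR N * rsum t (fun a => P (Y a)) - zP = s ->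
        rsum t (fun a => P (Y a) - zP) = INR N * s).
      { intros P zP s <-; rewrite rsum_sub.
        replace (rsum t (fun _ => zP)) with (INR N * zP); [field; lra|].
        rewrite <- (proj1 (in_tuples _ _ _ Ht)); clear.
        induction t as [|a t IH]; [simpl; ring|].
        simpl length; rewrite S_INR; simpl; rewrite <- IH; ring. }
      rewrite Cmod_sqr; unfold X1, X2.
      rewrite (Hmean fst _ _ eq_refl), (Hmean snd _ _ eq_refl).
      unfold mean; rewrite (proj1 (in_tuples _ _ _ Ht)); simpl.
      rewrite lsum_fst, lsum_snd; field; lra. }
    rewrite Rmult_assoc, <- Hd.
    assert (Hdisc := mean_in_disc Y t HY).
    destruct (Rlt_dec (Cmod (mean Y t - z)%Cx) delta) as [Hlt | Hge].
    { specialize (Hg _ Hdisc Hlt).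
      assert (0 <= M * Cmod (mean Y t - z)%Cx ^ 2) by (apply Rmult_le_pos; [easy | nra]); lra. }
    { assert (H1 : 2 * B <= M * Cmod (mean Y t - z)%Cx ^ 2).
      { replace (2 * B) with (M * delta ^ 2) by (unfold M; field; lra).
        apply Rmult_le_compat_l; [easy|]; apply pow_incr; lra. }
      pose proof (HB _ Hdisc); pose proof (HB _ Hzd).
      pose proof (Cmod_sub_triangle (g (mean Y t)) C0 (g z)) as H2.
      rewrite (Cmod_sub_sym C0) in H2.
      replace (g (mean Y t) - C0)%Cx with (g (mean Y t)) in H2 by ring.
      replace (g z - C0)%Cx with (g z) in H2 by ring; lra. } }
  rewrite expect_add, expect_const, expect_mul_l, expect_add.
  pose proof (expect_sum_sqr N X1 4 E1 HX1); pose proof (expect_sum_sqr N X2 4 E2 HX2).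
  apply Rplus_le_compat_l.
  replace (16 * B / (INR N * delta ^ 2)) with (M * / INR N ^ 2 * (INR N * 4 + INR N * 4))
    by (unfold M; field; split; lra).
  apply Rmult_le_compat_l; [|lra].
  apply Rmult_le_pos; [easy|]; left; apply Rinv_0_lt_compat; nra.
Qed.

End LargeNumbers.

(** * Fourier coefficients of functions on the sphere *)

(** Test [k] at the product points [(y s, x j)] with the product coefficients [c s * d j]. *)
Lemma pd_average {Y X I} (k : Y * X -> Y * X -> Cx) (l : list I) (y : I -> Y) (c : I -> Cx) :
  pos_def_kernel k ->
  pos_def_kernel (fun u v => lsum l (fun s => lsum l (fun t =>
    k (y s, u) (y t, v) * (c s * Cconj (c t)))))%Cx.
Proof.
  intros H n x d.
  pose proof (pd_lsum k (list_prod l (seq 0 n)) (fun i => (y (fst i), x (snd i)))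
    (fun i => c (fst i) * d (snd i))%Cx H) as H1.
  match goal with |- Cnonneg ?e => match type of H1 with Cnonneg ?e' => replace e with e' end end;
    [exact H1|].
  rewrite csum_lsum, lsum_list_prod, lsum_swap.
  symmetry; apply lsum_ext; intros j _; rewrite csum_lsum.
  rewrite (lsum_ext _ _ (fun m => lsum l (fun s => lsum l (fun t =>
    k (y s, x j) (y t, x m) * (c s * Cconj (c t)) * (d j * Cconj (d m)))))%Cx).
  { rewrite lsum_swap; apply lsum_ext; intros s _.
    rewrite lsum_list_prod, lsum_swap; apply lsum_ext; intros m _.
    apply lsum_ext; intros t _; simpl; rewrite Cconj_mul; ring. }
  intros m _; rewrite <- !lsum_mul_r; apply lsum_ext; intros s _.
  rewrite <- !lsum_mul_r; apply lsum_ext; intros t _; ring.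
Qed.

(** Coordinates past the end of [a] take the index 0, which also gives a root of unity, so every
    list yields a unit vector. *)
Definition torus_vector (N p : nat) (a : list nat) (k : nat) : Cx :=
  (RtoC (/ sqrt (INR N)) * root p (nth k a O))%Cx.

Lemma Rinv_sqrt_sqr N : (0 < N)%nat -> / sqrt (INR N) * / sqrt (INR N) = / INR N.
Proof.
  intros HN; assert (0 < INR N) by (now apply lt_0_INR).
  rewrite <- Rinv_mult, sqrt_sqrt; lra.
Qed.

Lemma torus_vector_unit N p a :
  (0 < N)%nat ->
  csum N (fun k => torus_vector N p a k * Cconj (torus_vector N p a k))%Cx = RtoC 1.
Proof.
  intros HN; rewrite csum_lsum, (lsum_ext _ _ (fun _ => RtoC (/ INR N))).
  { rewrite lsum_const, length_seq, <- RtoC_mul; f_equal; field.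
    apply not_0_INR; lia. }
  intros k _; rewrite Cmul_conj; unfold torus_vector, root.
  rewrite Cmod_mul, Cmod_cis, Cmod_RtoC, Rmult_1_r, pow2_abs; f_equal.
  rewrite <- Rinv_sqrt_sqr by easy; ring.
Qed.

Definition torus_point (N p : nat) (HN : (0 < N)%nat) (a : list nat) : Omega N :=
  exist _ (torus_vector N p a) (torus_vector_unit N p a HN).

(** The two factors 1 / sqrt N combine to the 1 / N of a mean, so restricting [f] to the torus
    evaluates it at means of quotients. *)
Lemma herm_torus N p a b :
  (0 < N)%nat -> length a = N -> length b = N ->
  herm N (torus_vector N p a) (torus_vector N p b) = mean (quot p) (combine a b).
Proof.
  intros HN Ha Hb; unfold herm, mean; rewrite length_combine, Ha, Hb, Nat.min_id.
  rewrite <- (lsum_seq_nth (combine a b) (O, O)), length_combine, Ha, Hb, Nat.min_id.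
  rewrite csum_lsum, <- lsum_mul_l; apply lsum_ext; intros k _.
  rewrite combine_nth by congruence; unfold quot, torus_vector; simpl fst; simpl snd.
  rewrite Cconj_mul, Cconj_RtoC, <- (Rinv_sqrt_sqr N), RtoC_mul by easy; ring.
Qed.

Definition psi_tuple (p : nat) (k : list (nat * nat)) (a : list nat) : Cx :=
  lprod (combine k a) (fun t => psi p (fst t) (snd t)).

(** The diagonal Fourier coefficient at the character [k] of the kernel on the finite torus. The
    order 2 N + 1 resolves frequencies up to [N] in each of the [N] coordinates, so dimension and
    truncation grow together. *)
Definition fourier {L : LCGroup} (f : Cx -> L -> Cx) (N : nat) (k : list (nat * nat)) (u : L) :
    Cx :=
  let p := (2 * N + 1)%nat in
  lsum (tuples (seq 0 p) N) (fun a => lsum (tuples (seq 0 p) N) (fun b =>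
    f (mean (quot p) (combine a b)) u * (psi_tuple p k a * Cconj (psi_tuple p k b))))%Cx.

Definition degree (k : list (nat * nat)) : nat * nat :=
  (list_sum (map fst k), list_sum (map snd k)).

Section Sphere.
Context {L : LCGroup} (f : Cx -> L -> Cx).

Lemma pd_fourier N k :
  (0 < N)%nat -> P_Omega N f -> pos_def_kernel (fun u v : L => fourier f N k (gmul (ginv u) v)).
Proof.
  intros HN [_ H]; set (p := (2 * N + 1)%nat).
  pose proof (pd_average _ (tuples (seq 0 p) N) (torus_point N p HN) (psi_tuple p k) H) as H1.
  eapply pd_ext; [|exact H1]; intros u v; simpl; unfold fourier; fold p.
  apply lsum_ext; intros a Ha; apply lsum_ext; intros b Hb.
  rewrite herm_torus; [easy | easy | now apply in_tuples in Ha | now apply in_tuples in Hb].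
Qed.

Lemma lprod_combine_weight p z k a b :
  length k = length a -> length k = length b ->
  lprod (combine k (combine a b)) (fun t => mono z (fst t) *
    (psi p (fst t) (fst (snd t)) * Cconj (psi p (fst t) (snd (snd t)))))%Cx =
  (mono z (degree k) * (psi_tuple p k a * Cconj (psi_tuple p k b)))%Cx.
Proof.
  unfold degree; rewrite <- mono_lprod; unfold psi_tuple.
  revert a b; induction k as [|j k IH]; intros [|x a] [|y b] Ha Hb; try discriminate.
  { simpl; rewrite Cconj_RtoC; ring. }
  { injection Ha as Ha; injection Hb as Hb; simpl; rewrite IH by easy.
    rewrite Cconj_mul; ring. }
Qed.

(** For fixed [a] and [b], the sum over the characters [k] factors over the coordinates into a
    product of weights. The left side displays coefficients that are positive definite in [u], the
    right side an expectation. *)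
Lemma fourier_sum N z u :
  lsum (tuples (dual N) N) (fun k => fourier f N k u * mono z (degree k))%Cx =
  lsum (tuples (grid N) N) (fun t =>
    lprod t (weight N z) * f (mean (quot (2 * N + 1)) t) u)%Cx.
Proof.
  unfold grid; rewrite lsum_tuples_list_prod; unfold fourier; set (p := (2 * N + 1)%nat).
  rewrite (lsum_ext _ _ _ (fun k _ => eq_sym (lsum_mul_r _ _ _))), lsum_swap.
  apply lsum_ext; intros a Ha.
  rewrite (lsum_ext _ _ _ (fun k _ => eq_sym (lsum_mul_r _ _ _))), lsum_swap.
  apply lsum_ext; intros b Hb.
  apply in_tuples in Ha as [Ha _]; apply in_tuples in Hb as [Hb _].
  assert (Hab : length (combine a b) = N) by (rewrite length_combine; lia).
  pose proof (lsum_tuples_lprod (dual N) (combine a b) (fun t => mono z (fst t) *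
    (psi p (fst t) (fst (snd t)) * Cconj (psi p (fst t) (snd (snd t)))))%Cx) as HW.
  match type of HW with _ = ?e => change e with (lprod (combine a b) (weight N z)) in HW end.
  rewrite <- HW, Hab, <- lsum_mul_r; apply lsum_ext; intros k Hk.
  apply in_tuples in Hk as [Hk _]; rewrite lprod_combine_weight by congruence; ring.
Qed.

Lemma weights_eventually_ge_0 r :
  0 <= r < 1 -> exists N0, forall N, (N0 <= N)%nat -> 6 * r ^ S N <= 1 - r ^ 2.
Proof.
  intros Hr; destruct (pow_lt_1_zero r ltac:(rewrite Rabs_pos_eq; lra) ((1 - r ^ 2) / 6))
    as [N0 HN0]; [nra|].
  exists N0; intros N HN; specialize (HN0 (S N) ltac:(lia)).
  rewrite Rabs_pos_eq in HN0 by (apply pow_le; lra); lra.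
Qed.

Lemma lprod_weight N z t :
  Cmod z < 1 -> 6 * Cmod z ^ S N <= 1 - Cmod z ^ 2 ->
  lprod t (weight N z) = RtoC (rprod t (fun s => fst (weight N z s))).
Proof.
  intros Hz HN; rewrite RtoC_rprod; apply lprod_ext; intros s _.
  apply Cx_eq; [easy | apply (weight_ge_0 N z s Hz HN)].
Qed.

Lemma weight_sum N z :
  rsum (grid N) (fun t => fst (weight N z t)) = 1.
Proof.
  pose proof (weight_moment N z (O, O)) as H.
  rewrite <- lsum_fst.
  rewrite (lsum_ext _ _ (fun t => weight N z t * mono (quot (2 * N + 1) t) (0, 0)%nat)%Cx).
  { rewrite H; [unfold mono; simpl; ring | now left]. }
  intros t _; unfold mono; simpl; ring.
Qed.

(** The moment of frequency 1, which lies in [dual N] only for positive [N]. *)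
Lemma weight_mean N z :
  (0 < N)%nat ->
  lsum (grid N) (fun t => weight N z t * quot (2 * N + 1) t)%Cx = z.
Proof.
  intros HN; pose proof (weight_moment N z (1%nat, O)) as H.
  rewrite (lsum_ext _ _ (fun t => weight N z t * mono (quot (2 * N + 1) t) (1, 0)%nat)%Cx).
  { rewrite H; [unfold mono; simpl; ring|].
    apply in_or_app; left; apply in_map_iff; exists 1%nat; split; [easy|].
    apply in_seq; lia. }
  intros t _; unfold mono; simpl; ring.
Qed.

Lemma quot_in_disc p t : in_disc (quot p t).
Proof.
  unfold in_disc, quot, root; rewrite Cmod_mul, Cmod_conj, !Cmod_cis; lra.
Qed.

Context (f_cont : contDL f) (B : R) (f_bound : forall z u, in_disc z -> Cmod (f z u) <= B).

Lemma Cmod_fourier_sum_le z u :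
  Cmod z < 1 -> exists N0, forall N, (N0 <= N)%nat ->
    Cmod (lsum (tuples (dual N) N) (fun k => fourier f N k u * mono z (degree k))%Cx) <= B.
Proof.
  intros Hz; destruct (weights_eventually_ge_0 (Cmod z)) as [N0 HN0];
    [split; [apply Cmod_ge_0 | easy]|].
  exists N0; intros N HN; specialize (HN0 N HN); rewrite fourier_sum.
  erewrite lsum_ext by (intros t _; rewrite lprod_weight by easy; reflexivity).
  apply Cmod_expect_le.
  { intros t _; apply (weight_ge_0 N z t Hz HN0). }
  { apply weight_sum. }
  { intros t _; apply f_bound, mean_in_disc, quot_in_disc. }
Qed.

Lemma fourier_sum_cv z u :
  Cmod z < 1 ->
  Cseq_cv (fun N => lsum (tuples (dual N) N) (fun k => fourier f N k u * mono z (degree k))%Cx)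
    (f z u).
Proof.
  intros Hz eps Heps.
  assert (Hzd : in_disc z) by (unfold in_disc; lra).
  destruct (weights_eventually_ge_0 (Cmod z)) as [N0 HN0]; [split; [apply Cmod_ge_0 | easy]|].
  destruct (f_cont z u (eps / 2) Hzd ltac:(lra)) as (delta & V & Hdelta & _ & HVu & HV).
  assert (HB : 0 <= B) by (pose proof (f_bound z u Hzd); pose proof (Cmod_ge_0 (f z u)); lra).
  assert (Hd2 : 0 < delta ^ 2) by (now apply pow_lt).
  (* Chosen so that the Chebyshev term 16 B / (N delta^2) falls below eps / 2. The successor in the
     next witness makes [N] positive and strictly larger than [N1]. *)
  destruct (INR_unbounded (32 * B / (eps * delta ^ 2))) as [N1 HN1].
  exists (S (max N0 N1)); intros N HN; specialize (HN0 N ltac:(lia)); rewrite fourier_sum.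
  assert (HNR : INR N1 < INR N) by (apply lt_INR; lia).
  erewrite lsum_ext by (intros t _; rewrite lprod_weight by easy; reflexivity).
  eapply Rle_lt_trans.
  { apply (large_numbers (grid N) (fun s => fst (weight N z s))) with
      (B := B) (eps := eps / 2) (delta := delta) (z := z) (g := fun y => f y u); try easy.
    { intros t _; apply (weight_ge_0 N z t Hz HN0). }
    { apply weight_sum. }
    { lia. }
    { rewrite <- (weight_mean N z) at 1 by lia; apply lsum_ext; intros t _; f_equal.
      apply Cx_eq; [easy | symmetry; apply (weight_ge_0 N z t Hz HN0)]. }
    { apply quot_in_disc. }
    { lra. }
    { intros y Hy; now apply f_bound. }
    { intros y Hy Hyz; apply Rlt_le, HV; easy. } }
  pose proof (pos_INR N1).
  assert (H1 : 32 * B < INR N * (eps * delta ^ 2)).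
  { assert (He : 0 < eps * delta ^ 2) by nra.
    apply Rlt_trans with (1 := HN1) in HNR.
    apply (Rmult_lt_compat_r _ _ _ He) in HNR.
    replace (32 * B / (eps * delta ^ 2) * (eps * delta ^ 2)) with (32 * B) in HNR
      by (field; split; lra); exact HNR. }
  assert (H2 : 16 * B / (INR N * delta ^ 2) < eps / 2); [|lra].
  apply Rmult_lt_reg_r with (INR N * delta ^ 2); [nra|].
  replace (16 * B / (INR N * delta ^ 2) * (INR N * delta ^ 2)) with (16 * B)
    by (field; split; lra); nra.
Qed.

End Sphere.

(** * Square partial sums *)

Definition square (K : nat) : list (nat * nat) := list_prod (seq 0 K) (seq 0 K).

(** What [square (S K)] adds to [square K]; the corner [(K, K)] is counted in the second part. *)
Definition shell (K : nat) : list (nat * nat) :=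
  map (fun m => (m, K)) (seq 0 K) ++ map (fun n => (K, n)) (seq 0 (S K)).

Lemma in_square K j : In j (square K) <-> (fst j < K /\ snd j < K)%nat.
Proof. destruct j; unfold square; rewrite in_prod_iff, !in_seq; simpl; lia. Qed.

Lemma NoDup_list_prod {I J} (l : list I) (l' : list J) :
  NoDup l -> NoDup l' -> NoDup (list_prod l l').
Proof.
  intros Hl Hl'; induction Hl as [|i l Hi Hl IH]; simpl; [constructor|].
  apply NoDup_app; [|exact IH|].
  { apply NoDup_map_NoDup_ForallPairs; [|exact Hl']; intros ? ? _ _ [=]; auto. }
  { intros [i' j] H1 H2; apply in_map_iff in H1 as (j' & [= <- _] & _).
    now apply in_prod_iff in H2. }
Qed.

Lemma NoDup_square K : NoDup (square K).
Proof. apply NoDup_list_prod; apply seq_NoDup. Qed.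

Lemma lsum_square_S K F : lsum (square (S K)) F = (lsum (square K) F + lsum (shell K) F)%Cx.
Proof.
  unfold square, shell; rewrite lsum_app, !lsum_map, !lsum_list_prod.
  rewrite (seq_S K 0) at 1; rewrite lsum_app.
  rewrite (lsum_ext (seq 0 K) _ (fun m => lsum (seq 0 K) (fun n => F (m, n)) + F (m, K))%Cx).
  { rewrite lsum_add; cbn [lsum fold_right Nat.add]; fold (@lsum nat); ring. }
  intros m _; rewrite seq_S, lsum_app; simpl; ring.
Qed.

Lemma rsum_square_S K F : rsum (square (S K)) F = rsum (square K) F + rsum (shell K) F.
Proof.
  pose proof (lsum_square_S K (fun j => RtoC (F j))) as H.
  rewrite <- !RtoC_rsum, <- RtoC_add in H; exact (f_equal fst H).
Qed.

Lemma lsum_square_tail K M F b :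
  (forall j, Cmod (F j) <= b j) -> (K <= M)%nat ->
  Cmod (lsum (square M) F - lsum (square K) F)%Cx <= rsum (square M) b - rsum (square K) b.
Proof.
  intros Hb; induction 1 as [|M HM IH].
  { replace (_ - _)%Cx with C0 by ring; rewrite Cmod_C0; lra. }
  rewrite lsum_square_S, rsum_square_S.
  replace (_ - _)%Cx with ((lsum (square M) F - lsum (square K) F) + lsum (shell M) F)%Cx by ring.
  pose proof (Cmod_triangle (lsum (square M) F - lsum (square K) F) (lsum (shell M) F)).
  pose proof (Cmod_lsum (shell M) F).
  pose proof (rsum_le (shell M) _ _ (fun j _ => Hb j)); lra.
Qed.

Lemma csum_csum_square K (F : nat -> nat -> Cx) :
  csum K (fun m => csum K (F m)) = lsum (square K) (fun j => F (fst j) (snd j)).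
Proof.
  unfold square; rewrite csum_lsum, lsum_list_prod; apply lsum_ext; intros m _; apply csum_lsum.
Qed.

Lemma dpartial_square {L : LCGroup} (phi : nat -> nat -> L -> Cx) K z u :
  dpartial phi K z u = lsum (square K) (fun j => phi (fst j) (snd j) u * mono z j)%Cx.
Proof. unfold dpartial; now rewrite csum_csum_square. Qed.

(** Partial sums of the majorant series: a positive definite function is bounded by its value at the
    neutral element, so increments of [mass] control those of the double series on the whole closed
    disc and group. *)
Definition mass {L : LCGroup} (phi : nat -> nat -> L -> Cx) (K : nat) : R :=
  rsum (square K) (fun j => fst (phi (fst j) (snd j) gone)).

Lemma csum_mass {L : LCGroup} (phi : nat -> nat -> L -> Cx) K :
  fst (csum K (fun m => csum K (fun n => phi m n gone))) = mass phi K.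
Proof. now rewrite csum_csum_square, lsum_fst. Qed.

(** * Positive definite functions on a group *)

Definition pdL {L : LCGroup} (phi : L -> Cx) : Prop :=
  pos_def_kernel (fun u v : L => phi (gmul (ginv u) v)).

Lemma ginv_gone (L : LCGroup) : ginv (gone : L) = gone.
Proof. rewrite <- (gmul1r _ (ginv gone)); apply gmulVl. Qed.

Lemma gmul_ginv_gone {L : LCGroup} (u : L) : gmul (ginv gone) u = u.
Proof. rewrite ginv_gone; apply gmul1l. Qed.

Lemma pdL_bound {L : LCGroup} (phi : L -> Cx) u : pdL phi -> Cmod (phi u) <= fst (phi gone).
Proof.
  intros H; pose proof (pd_bound _ gone u H) as H1; simpl in H1.
  rewrite !gmul_ginv_gone, gmulVl in H1; auto.
Qed.

Lemma pdL_gone {L : LCGroup} (phi : L -> Cx) : pdL phi -> Cnonneg (phi gone).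
Proof.
  intros H; pose proof (pd_diag _ gone H) as H1; simpl in H1.
  rewrite gmul_ginv_gone in H1; auto.
Qed.

Lemma Cmod_term_le {L : LCGroup} (phi : L -> Cx) u z j :
  pdL phi -> in_disc z -> Cmod (phi u * mono z j)%Cx <= fst (phi gone).
Proof.
  intros H Hz; rewrite Cmod_mul, Cmod_mono.
  pose proof (pdL_bound phi u H); pose proof (Cmod_ge_0 (phi u)); pose proof (Cmod_ge_0 z).
  pose proof (pow_le_1 (Cmod z) (fst j + snd j) ltac:(split; [apply Cmod_ge_0 | apply Hz])).
  assert (0 <= Cmod z ^ (fst j + snd j)) by (now apply pow_le); nra.
Qed.

Lemma dpartial_tail {L : LCGroup} (phi : nat -> nat -> L -> Cx) K M z u :
  (forall m n, pdL (phi m n)) -> in_disc z -> (K <= M)%nat ->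
  Cmod (dpartial phi M z u - dpartial phi K z u)%Cx <= mass phi M - mass phi K.
Proof.
  intros H Hz HK; rewrite !dpartial_square; apply lsum_square_tail; [|easy].
  intros j; now apply Cmod_term_le.
Qed.

Lemma mass_growing {L : LCGroup} (phi : nat -> nat -> L -> Cx) :
  (forall m n, pdL (phi m n)) -> Un_growing (mass phi).
Proof.
  intros H K; unfold mass; rewrite rsum_square_S.
  assert (0 <= rsum (shell K) (fun j => fst (phi (fst j) (snd j) gone))); [|lra].
  apply rsum_ge_0; intros j _; apply (pdL_gone _ (H _ _)).
Qed.

Lemma Cseq_cv_le x l y C K :
  Cseq_cv x l -> (forall M, (K <= M)%nat -> Cmod (x M - y)%Cx <= C) -> Cmod (l - y)%Cx <= C.
Proof.
  intros Hx HC; apply le_epsilon; intros eps Heps.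
  destruct (Hx eps Heps) as [N HN].
  specialize (HN (max N K) ltac:(lia)); specialize (HC (max N K) ltac:(lia)).
  rewrite Cmod_sub_sym in HN.
  pose proof (Cmod_sub_triangle l (x (max N K)) y); lra.
Qed.

Lemma dpartial_limit {L : LCGroup} (phi : nat -> nat -> L -> Cx) a y K z u :
  (forall m n, pdL (phi m n)) -> Un_cv (mass phi) a -> in_disc z ->
  Cseq_cv (fun N => dpartial phi N z u) y ->
  Cmod (y - dpartial phi K z u)%Cx <= a - mass phi K.
Proof.
  intros H Ha Hz Hy; apply (Cseq_cv_le _ _ _ _ K Hy); intros M HM.
  pose proof (dpartial_tail phi K M z u H Hz HM).
  pose proof (growing_ineq _ _ (mass_growing phi H) Ha M); lra.
Qed.

Lemma Un_cv_mass_small {L : LCGroup} (phi : nat -> nat -> L -> Cx) a eps :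
  Un_cv (mass phi) a -> 0 < eps ->
  exists N, forall M, (N <= M)%nat -> a - mass phi M < eps.
Proof.
  intros Ha Heps; destruct (Ha eps Heps) as [N HN]; exists N; intros M HM.
  specialize (HN M HM); unfold Rdist in HN; rewrite Rabs_minus_sym in HN.
  apply Rle_lt_trans with (2 := HN), Rle_abs.
Qed.

(** Weierstrass' test: the remainder is at most the tail of [mass], which depends on neither [z] nor
    [u]. *)
Lemma expansion_unif_cv {L : LCGroup} (phi : nat -> nat -> L -> Cx) (f : Cx -> L -> Cx) :
  expansion phi f -> unif_cv phi f.
Proof.
  intros (Hpd & [a Ha] & Hcv) eps Heps.
  apply (Un_cv_ext _ (mass phi)) in Ha; [|intros; apply csum_mass].
  destruct (Un_cv_mass_small phi a eps Ha Heps) as [N HN]; exists N; intros M HM z u Hz.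
  rewrite Cmod_sub_sym.
  apply Rle_lt_trans with (2 := HN M HM), dpartial_limit; auto; intros; apply Hpd.
Qed.

(** * From expansions to positive definite functions *)

Lemma pd_const_1 {X : Type} : pos_def_kernel (fun _ _ : X => RtoC 1).
Proof.
  intros n x c; rewrite csum_lsum.
  rewrite (lsum_ext _ _ (fun j => c j * Cconj (lsum (seq 0 n) c))%Cx).
  { rewrite lsum_mul_r, Cmul_conj; split; [easy|]; simpl; nra. }
  intros j _; rewrite csum_lsum, lsum_conj, <- lsum_mul_l; apply lsum_ext; intros; ring.
Qed.

Lemma pd_mul_pow {X I} (k : X -> X -> Cx) (l : list I) (g : I -> X -> Cx) n :
  pos_def_kernel k ->
  pos_def_kernel (fun x y => k x y * Cpow (lsum l (fun i => g i x * Cconj (g i y))) n)%Cx.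
Proof.
  intros H; induction n as [|n IH].
  { apply (pd_ext k); [intros; simpl; ring | easy]. }
  { apply (pd_gram _ l g) in IH; eapply pd_ext; [|exact IH]; intros; simpl; ring. }
Qed.

(** Cauchy-Schwarz, read off from [pd_bound] for the Gram kernel, whose diagonal is 1. *)
Lemma herm_in_disc q (x y : Omega q) : in_disc (herm q (proj1_sig x) (proj1_sig y)).
Proof.
  pose proof (pd_gram (fun _ _ : Omega q => RtoC 1) (seq 0 q) (fun i x => proj1_sig x i)
    pd_const_1) as H.
  assert (E : forall a : Omega q, (RtoC 1 * lsum (seq 0 q)
    (fun i => proj1_sig a i * Cconj (proj1_sig a i)))%Cx = RtoC 1).
  { intros [a Ha]; simpl; rewrite <- csum_lsum, Ha; ring. }
  apply (pd_bound _ x y) in H; [|now rewrite !E].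
  cbv beta in H; rewrite E in H; unfold in_disc, herm; rewrite csum_lsum.
  replace (lsum _ _) with (RtoC 1 * lsum (seq 0 q)
    (fun i => proj1_sig x i * Cconj (proj1_sig y i)))%Cx by ring; exact H.
Qed.

Lemma pd_expansion_term {L : LCGroup} (phi : L -> Cx) q j :
  pdL phi ->
  pos_def_kernel (fun a b : Omega q * L =>
    phi (gmul (ginv (snd a)) (snd b)) * mono (herm q (proj1_sig (fst a)) (proj1_sig (fst b))) j)%Cx.
Proof.
  intros H.
  pose proof (pd_comap (fun a : Omega q * L => snd a) _ H) as H1; simpl in H1.
  apply (pd_mul_pow _ (seq 0 q) (fun i a => proj1_sig (fst a) i) (fst j)) in H1.
  (* The conjugated vectors have the conjugate of the hermitian product as Gram kernel. *)
  apply (pd_mul_pow _ (seq 0 q) (fun i a => Cconj (proj1_sig (fst a) i)) (snd j)) in H1.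
  eapply pd_ext; [|exact H1]; intros a b; simpl; unfold mono, herm.
  rewrite csum_lsum, lsum_conj.
  rewrite (lsum_ext _ _ _
    (fun i _ => Cconj_mul (proj1_sig (fst a) i) (Cconj (proj1_sig (fst b) i)))).
  assert (A : forall x y z, (x * y * z = x * (y * z))%Cx) by (intros; ring); apply A.
Qed.

Lemma expansion_P_Omega {L : LCGroup} (f : Cx -> L -> Cx) phi q :
  contDL f -> expansion phi f -> P_Omega q f.
Proof.
  intros Hf (Hpd & _ & Hcv); split; [exact Hf|].
  destruct ultrafilter_exists as [U HU].
  apply (ucv_pd HU) with (k := fun N (a b : Omega q * L) => dpartial phi N
    (herm q (proj1_sig (fst a)) (proj1_sig (fst b))) (gmul (ginv (snd a)) (snd b))).
  { apply (uf_eventually HU _ 0); intros N _.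
    eapply pd_ext; [intros; symmetry; apply dpartial_square|].
    apply pd_lsum_kernel; intros j _; apply pd_expansion_term, Hpd. }
  { intros a b; apply (ucv_of_cv HU), Hcv, herm_in_disc. }
Qed.

(** * Limits of positive definite polynomials *)

(** Serves to let a radius 1 - t tend to 1 from inside the open disc. *)
Lemma le_of_linear_error x y C : (forall t, 0 < t <= 1 / 2 -> x <= y + C * t) -> x <= y.
Proof.
  intros H; apply le_epsilon; intros eps Heps.
  pose proof (Rabs_pos C) as HC; pose proof (Rle_abs C) as HC'.
  set (s := eps / (Rabs C + 1)).
  assert (Hs : 0 < s) by (apply Rdiv_lt_0_compat; lra).
  set (t := Rmin (1 / 2) s).
  assert (Ht : 0 < t <= 1 / 2)
    by (split; [apply Rmin_glb_lt; lra | apply Rmin_l]).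
  specialize (H t Ht).
  assert (C * t <= eps); [|lra].
  apply Rle_trans with (Rabs C * s).
  { pose proof (Rmin_r (1 / 2) s : t <= s); nra. }
  { replace eps with ((Rabs C + 1) * s) by (unfold s; field; lra); nra. }
Qed.

Lemma pow_one_minus n t : 0 <= t <= 1 -> 1 - INR n * t <= (1 - t) ^ n.
Proof.
  intros Ht; induction n as [|n IH]; [simpl; lra|].
  rewrite S_INR; simpl; pose proof (pos_INR n).
  assert (0 <= INR n * t * t) by (repeat apply Rmult_le_pos; lra); nra.
Qed.

(** Bernoulli's inequality, the total degree on the square being at most 2 K. *)
Lemma pow_one_minus_square K j t :
  In j (square K) -> 0 <= t <= 1 -> 1 - 2 * INR K * t <= (1 - t) ^ (fst j + snd j).
Proof.
  intros Hj Ht; apply in_square in Hj.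
  eapply Rle_trans; [|apply pow_one_minus; easy].
  assert (INR (fst j + snd j) <= INR (2 * K)) by (apply le_INR; lia).
  rewrite mult_INR in H; simpl (INR 2) in H; nra.
Qed.

Definition pair_dec : forall i j : nat * nat, {i = j} + {i <> j}.
Proof. decide equality; apply Nat.eq_dec. Defined.

Section PolynomialLimit.
Context {L : LCGroup} {I : Type}.
Context (l : nat -> list I) (deg : I -> nat * nat) (c : nat -> I -> L -> Cx).
Context (f : Cx -> L -> Cx) (B : R).

Definition poly_at N z u : Cx := lsum (l N) (fun i => c N i u * mono z (deg i))%Cx.

Hypothesis c_pd : exists N0, forall N i, (N0 <= N)%nat -> pdL (c N i).
Hypothesis poly_cv : forall z u, Cmod z < 1 -> Cseq_cv (fun N => poly_at N z u) (f z u).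
Hypothesis poly_bound : forall r, 0 <= r < 1 -> exists N0, forall N, (N0 <= N)%nat ->
  Cmod (poly_at N (RtoC r) gone) <= B.

(** Collects the terms of equal bidegree, since many characters share the same total frequencies. *)
Definition coef N m n u : Cx :=
  lsum (l N) (fun i => if pair_dec (m, n) (deg i) then c N i u else C0).

(** The real part of the polynomial at radius [r] and the neutral element. For positive definite
    coefficients it dominates the moduli of the terms at every point of modulus [r]. *)
Definition majorant N r : R :=
  rsum (l N) (fun i => fst (c N i gone) * r ^ (fst (deg i) + snd (deg i))).

Lemma majorant_le r : 0 <= r < 1 -> exists N0, forall N, (N0 <= N)%nat -> majorant N r <= B.
Proof.
  intros Hr; destruct (poly_bound r Hr) as [N0 HN0]; exists N0; intros N HN.
  eapply Rle_trans; [|apply HN0, HN].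
  eapply Rle_trans; [|apply fst_le_Cmod].
  eapply Rle_trans; [|apply Rle_abs].
  unfold poly_at; rewrite lsum_fst; right; apply rsum_ext; intros i _.
  rewrite mono_RtoC; simpl; ring.
Qed.

Lemma coef_square N K z u :
  lsum (square K) (fun j => coef N (fst j) (snd j) u * mono z j)%Cx =
  lsum (l N) (fun i => if in_dec pair_dec (deg i) (square K)
                       then (c N i u * mono z (deg i))%Cx else C0).
Proof.
  unfold coef; rewrite (lsum_ext _ _ _ (fun j _ => eq_sym (lsum_mul_r _ _ _))), lsum_swap.
  apply lsum_ext; intros i _.
  destruct (in_dec _ _ _) as [Hi | Hi].
  { rewrite (lsum_single _ _ (deg i) (NoDup_square K) Hi).
    { destruct (pair_dec _ _) as [_ | H]; [easy | now destruct H; rewrite <- surjective_pairing]. }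
    intros j _ Hj; destruct (pair_dec _ _) as [H | _]; [|ring].
    now destruct Hj; rewrite (surjective_pairing j). }
  { apply lsum_0; intros j Hj; destruct (pair_dec _ _) as [H | _]; [|ring].
    rewrite <- surjective_pairing in H; now rewrite <- H in Hi. }
Qed.

Lemma Cmod_coef_square_le N K z u :
  (forall i, pdL (c N i)) ->
  Cmod (lsum (square K) (fun j => coef N (fst j) (snd j) u * mono z j))%Cx
    <= majorant N (Cmod z).
Proof.
  intros Hpd; rewrite coef_square; eapply Rle_trans; [apply Cmod_lsum|].
  apply rsum_le; intros i _.
  assert (H0 : 0 <= Cmod z ^ (fst (deg i) + snd (deg i))) by (apply pow_le, Cmod_ge_0).
  pose proof (pdL_gone _ (Hpd i)) as [_ H1]; pose proof (pdL_bound _ u (Hpd i)).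
  destruct (in_dec _ _ _); [rewrite Cmod_mul, Cmod_mono | rewrite Cmod_C0]; nra.
Qed.

(** Outside the square the total degree d is at least [K], so |z|^d is at most (|z| / r)^K r^d. The
    majorant being bounded, this truncation error is uniform in [N], which allows the limit in [N]
    to be taken before that in [K]. *)
Lemma coef_tail N K z u r :
  (forall i, pdL (c N i)) -> Cmod z < r ->
  Cmod (poly_at N z u - lsum (square K) (fun j => coef N (fst j) (snd j) u * mono z j))%Cx
    <= (Cmod z / r) ^ K * majorant N r.
Proof.
  intros Hpd Hr; pose proof (Cmod_ge_0 z) as Hz.
  rewrite coef_square; unfold poly_at, majorant; rewrite <- lsum_sub, <- rsum_mul_l.
  eapply Rle_trans; [apply Cmod_lsum|]; apply rsum_le; intros i _.
  set (d := (fst (deg i) + snd (deg i))%nat).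
  assert (Hq : 0 <= Cmod z / r <= 1).
  { split; [apply Rle_mult_inv_pos; lra|].
    apply Rmult_le_reg_r with r; [lra|]; unfold Rdiv; rewrite Rmult_assoc, Rinv_l; lra. }
  assert (HqK : 0 <= (Cmod z / r) ^ K) by (apply pow_le; lra).
  assert (Hrd : 0 < r ^ d) by (apply pow_lt; lra).
  pose proof (pdL_gone _ (Hpd i)) as [_ H1]; pose proof (pdL_bound _ u (Hpd i)) as H2.
  pose proof (Cmod_ge_0 (c N i u)).
  destruct (in_dec _ _ _) as [Hi | Hi].
  { replace (_ - _)%Cx with C0 by ring; rewrite Cmod_C0.
    repeat apply Rmult_le_pos; lra. }
  replace (_ - _)%Cx with (c N i u * mono z (deg i))%Cx by ring.
  rewrite Cmod_mul, Cmod_mono; fold d.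
  assert (HdK : (K <= d)%nat) by (rewrite in_square in Hi; unfold d; lia).
  replace (Cmod z ^ d) with ((Cmod z / r) ^ d * r ^ d)
    by (rewrite <- Rpow_mult_distr; f_equal; field; lra).
  pose proof (pow_decr (Cmod z / r) K d Hq HdK).
  assert (0 <= (Cmod z / r) ^ d) by (apply pow_le; lra).
  apply Rle_trans with (fst (c N i gone) * ((Cmod z / r) ^ K * r ^ d)); [|right; ring].
  apply Rmult_le_compat; [easy | apply Rmult_le_pos; lra | easy |].
  apply Rmult_le_compat_r; lra.
Qed.

Lemma polynomial_limit :
  exists phi : nat -> nat -> L -> Cx,
    (forall m n, pdL (phi m n)) /\ (forall K, mass phi K <= B) /\
    (forall z u, Cmod z < 1 -> Cseq_cv (fun K => dpartial phi K z u) (f z u)).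
Proof.
  destruct ultrafilter_exists as [U HU]; destruct c_pd as [N0 Hc].
  assert (Hcoef_pd : forall N m n, (N0 <= N)%nat -> pdL (coef N m n)).
  { intros N m n HN; unfold pdL, coef.
    apply (pd_lsum_kernel (l N) (fun i u v => if pair_dec (m, n) (deg i)
      then c N i (gmul (ginv u) v) else C0)).
    intros i _; destruct (pair_dec _ _); [apply Hc, HN | apply pd_0]. }
  assert (Hex : forall m n u, exists y, ucv (U := U) (fun N => coef N m n u) y).
  { intros m n u; destruct (majorant_le (1 / 2) ltac:(lra)) as [N1 HN1].
    (* A Cauchy estimate at radius 1/2: the coefficient times (1/2)^(m + n) is part of a majorant
       bounded by [B]. *)
    apply (ultra_limit HU _ (B * 2 ^ (m + n))).
    apply (uf_eventually HU _ (max N0 N1)); intros N HN; specialize (HN1 N ltac:(lia)).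
    eapply Rle_trans; [apply pdL_bound, Hcoef_pd; lia|].
    assert (H : fst (coef N m n gone) * (1 / 2) ^ (m + n) <= majorant N (1 / 2)).
    { unfold coef; rewrite lsum_fst, Rmult_comm, <- rsum_mul_l; apply rsum_le; intros i _.
      destruct (pdL_gone _ (Hc N i ltac:(lia))) as [_ H1].
      assert (0 < (1 / 2) ^ (fst (deg i) + snd (deg i))) by (apply pow_lt; lra).
      destruct (pair_dec _ _) as [E | E]; [rewrite <- E; simpl fst; simpl snd; lra | simpl; nra]. }
    apply Rmult_le_reg_r with ((1 / 2) ^ (m + n)); [apply pow_lt; lra|].
    rewrite Rmult_assoc, <- Rpow_mult_distr.
    replace (2 * (1 / 2)) with 1 by field; rewrite pow1; lra. }
  set (phi := fun m n u => proj1_sig (constructive_indefinite_description _ (Hex m n u))).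
  assert (Hphi : forall m n u, ucv (U := U) (fun N => coef N m n u) (phi m n u)).
  { intros m n u; exact (proj2_sig (constructive_indefinite_description _ (Hex m n u))). }
  assert (Hpart : forall K z u, ucv (U := U)
    (fun N => lsum (square K) (fun j => coef N (fst j) (snd j) u * mono z j)%Cx)
    (dpartial phi K z u)).
  { intros K z u; rewrite dpartial_square.
    apply (ucv_lsum HU _ (fun N j => coef N (fst j) (snd j) u * mono z j)%Cx).
    intros j _; apply (ucv_mul_r HU), Hphi. }
  assert (Hphi_pd : forall m n, pdL (phi m n)).
  { intros m n; apply (ucv_pd HU) with (k := fun N u v => coef N m n (gmul (ginv u) v)).
    { apply (uf_eventually HU _ N0); intros N HN; now apply Hcoef_pd. }
    { intros u v; apply Hphi. } }
  exists phi; split; [exact Hphi_pd|]; split.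
  (* The bound [B] holds at radius 1 - t; passing to radius 1 costs at most 2 K t times the mass,
     and t tends to 0. *)
  { intros K; apply le_of_linear_error with (2 * INR K * mass phi K); intros t Ht.
    destruct (majorant_le (1 - t) ltac:(lra)) as [N1 HN1].
    assert (H : Cmod (dpartial phi K (RtoC (1 - t)) gone) <= B).
    { apply (ucv_Cmod_le HU _ _ _ (Hpart K (RtoC (1 - t)) gone)).
      apply (uf_eventually HU _ (max N0 N1)); intros N HN.
      eapply Rle_trans; [apply Cmod_coef_square_le; intros; apply Hc; lia|].
      rewrite Cmod_RtoC_pos by lra; apply HN1; lia. }
    apply Rle_trans with (1 := Rle_trans _ _ _ (Rle_abs _) (fst_le_Cmod _)) in H.
    rewrite dpartial_square, lsum_fst in H.
    assert (H1 : mass phi K * (1 - 2 * INR K * t) <= B); [|lra].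
    eapply Rle_trans; [|exact H]; unfold mass; rewrite Rmult_comm, <- rsum_mul_l.
    apply rsum_le; intros j Hj; rewrite mono_RtoC; cbn [fst Cmul RtoC].
    rewrite Rmult_comm, Rmult_0_r, Rminus_0_r; apply Rmult_le_compat_l.
    { apply (pdL_gone _ (Hphi_pd (fst j) (snd j))). }
    { apply pow_one_minus_square; [easy | lra]. } }
  { intros z u Hz eps Heps; pose proof (Cmod_ge_0 z) as Hz0.
    (* Any radius strictly between |z| and 1 makes the truncation error geometric in [K]. *)
    set (r := (1 + Cmod z) / 2).
    assert (Hr : Cmod z < r < 1) by (unfold r; lra).
    destruct (majorant_le r ltac:(lra)) as [N1 HN1].
    assert (HB : 0 <= B).
    { eapply Rle_trans; [|apply (HN1 (max N0 N1)); lia]; apply rsum_ge_0; intros i _.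
      apply Rmult_le_pos; [|apply pow_le; lra]; apply (pdL_gone _ (Hc (max N0 N1) i ltac:(lia))). }
    assert (Hq : 0 <= Cmod z / r < 1).
    { split; [apply Rle_mult_inv_pos; lra|].
      apply Rmult_lt_reg_r with r; [lra|]; unfold Rdiv; rewrite Rmult_assoc, Rinv_l; lra. }
    assert (Hdist : forall K, Cmod (f z u - dpartial phi K z u)%Cx <= (Cmod z / r) ^ K * B).
    { intros K; apply (ucv_Cmod_le HU _ _ _
        (ucv_sub HU _ _ _ _ (ucv_of_cv HU _ _ (poly_cv z u Hz)) (Hpart K z u))).
      apply (uf_eventually HU _ (max N0 N1)); intros N HN.
      eapply Rle_trans; [apply (coef_tail N K z u r); [intros; apply Hc; lia | lra]|].
      apply Rmult_le_compat_l; [apply pow_le; lra | apply HN1; lia]. }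
    destruct (pow_lt_1_zero (Cmod z / r) ltac:(rewrite Rabs_pos_eq; lra) (eps / (B + 1)))
      as [N2 HN2]; [apply Rdiv_lt_0_compat; lra|].
    exists N2; intros K HK; specialize (HN2 K HK); rewrite Cmod_sub_sym.
    eapply Rle_lt_trans; [apply Hdist|].
    assert (Hp : 0 <= (Cmod z / r) ^ K) by (apply pow_le; lra).
    rewrite Rabs_pos_eq in HN2 by easy.
    apply Rle_lt_trans with ((Cmod z / r) ^ K * (B + 1)); [nra|].
    apply (Rmult_lt_compat_r (B + 1)) in HN2; [|lra].
    replace (eps / (B + 1) * (B + 1)) with eps in HN2 by (field; lra); exact HN2. }
Qed.

End PolynomialLimit.

(** * From the open disc to the closed disc *)

Section ClosedDisc.
Context {L : LCGroup} (f : Cx -> L -> Cx) (phi : nat -> nat -> L -> Cx) (a : R).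
Hypothesis f_cont : contDL f.
Hypothesis phi_pd : forall m n, pdL (phi m n).
Hypothesis mass_cv : Un_cv (mass phi) a.
Hypothesis open_cv :
  forall z u, Cmod z < 1 -> Cseq_cv (fun K => dpartial phi K z u) (f z u).

Lemma dpartial_radial K t z u :
  in_disc z -> 0 <= t <= 1 ->
  Cmod (dpartial phi K (RtoC (1 - t) * z) u - dpartial phi K z u)%Cx <= 2 * INR K * t * mass phi K.
Proof.
  intros Hz Ht; rewrite !dpartial_square, <- lsum_sub; unfold mass; rewrite <- rsum_mul_l.
  eapply Rle_trans; [apply Cmod_lsum|]; apply rsum_le; intros j Hj.
  rewrite mono_mul, mono_RtoC; set (q := (1 - t) ^ _).
  replace (_ - _)%Cx with (RtoC (q - 1) * (phi (fst j) (snd j) u * mono z j))%Cx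
    by (apply Cx_eq; simpl; ring).
  rewrite Cmod_mul, Cmod_RtoC.
  assert (Hq : 1 - 2 * INR K * t <= q) by (now apply pow_one_minus_square).
  assert (Hq1 : q <= 1) by (apply pow_le_1; lra).
  rewrite Rabs_left1 by lra.
  apply Rmult_le_compat; [lra | apply Cmod_ge_0 | lra | now apply Cmod_term_le].
Qed.

(** The remainder bound in the open disc is independent of the point, so it extends to [z] along the
    radius, by continuity of [f] and of the fixed partial sum. *)
Lemma dpartial_dist K z u :
  in_disc z -> Cmod (f z u - dpartial phi K z u)%Cx <= a - mass phi K.
Proof.
  intros Hz; apply le_epsilon; intros eps Heps.
  destruct (f_cont z u eps Hz Heps) as (delta & V & Hdelta & _ & HVu & HV).
  apply le_of_linear_error with (2 * (2 * INR K * mass phi K) * Rmin 1 delta).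
  (* The scaling keeps [t] below both 1 and [delta] while the error stays linear in [s]. *)
  intros s Hs; set (t := s * Rmin 1 delta).
  assert (Hmin : 0 < Rmin 1 delta <= 1)
    by (split; [apply Rmin_glb_lt; lra | apply Rmin_l]).
  assert (Ht : 0 < t <= 1) by (unfold t; nra).
  assert (Htd : t < delta) by (pose proof (Rmin_r 1 delta); unfold t; nra).
  set (w := (RtoC (1 - t) * z)%Cx); pose proof (Cmod_ge_0 z).
  unfold in_disc in Hz.
  assert (Hw : Cmod w < 1) by (unfold w; rewrite Cmod_mul, Cmod_RtoC_pos; nra).
  assert (Hwd : in_disc w) by (unfold in_disc; lra).
  assert (Hwz : Cmod (w - z)%Cx < delta).
  { unfold w; replace (_ - _)%Cx with (RtoC (- t) * z)%Cx by (apply Cx_eq; simpl; ring).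
    rewrite Cmod_mul, Cmod_RtoC, Rabs_left by lra; nra. }
  specialize (HV w u Hwd Hwz HVu); rewrite Cmod_sub_sym in HV.
  pose proof (dpartial_limit phi a (f w u) K w u phi_pd mass_cv Hwd (open_cv w u Hw)).
  pose proof (dpartial_radial K t z u Hz ltac:(lra)) as Hrad; fold w in Hrad.
  pose proof (Cmod_sub_triangle (f z u) (f w u) (dpartial phi K z u)).
  pose proof (Cmod_sub_triangle (f w u) (dpartial phi K w u) (dpartial phi K z u)).
  assert (0 <= 2 * INR K * mass phi K * t).
  { pose proof (Cmod_ge_0 (dpartial phi K w u - dpartial phi K z u)); lra. }
  unfold t in *; lra.
Qed.

Lemma closed_cv z u : in_disc z -> Cseq_cv (fun K => dpartial phi K z u) (f z u).
Proof.
  intros Hz eps Heps; destruct (Un_cv_mass_small phi a eps mass_cv Heps) as [N HN].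
  exists N; intros M HM; rewrite Cmod_sub_sym.
  apply Rle_lt_trans with (2 := HN M HM), dpartial_dist, Hz.
Qed.

Lemma in_disc_1 : in_disc (RtoC 1).
Proof. unfold in_disc; rewrite Cmod_RtoC_pos; lra. Qed.

(* Every summand of [f 1 e - Re (f 1 u)] is nonnegative. *)
Lemma coefficient_increment m n u :
  fst (phi m n gone) - fst (phi m n u) <= fst (f (RtoC 1) gone) - fst (f (RtoC 1) u).
Proof.
  apply le_epsilon; intros eps Heps.
  destruct (closed_cv (RtoC 1) gone in_disc_1 (eps / 2) ltac:(lra)) as [N1 HN1].
  destruct (closed_cv (RtoC 1) u in_disc_1 (eps / 2) ltac:(lra)) as [N2 HN2].
  (* Large enough for both approximations and, through the final 1, for [(m, n)] to lie in the
     square. *)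
  set (K := (N1 + N2 + m + n + 1)%nat).
  specialize (HN1 K ltac:(lia)); specialize (HN2 K ltac:(lia)).
  apply Rle_lt_trans with (1 := fst_le_Cmod _) in HN1, HN2.
  apply Rabs_def2 in HN1, HN2; cbn [fst Csub] in HN1, HN2.
  assert (E : forall v, fst (dpartial phi K (RtoC 1) v) =
    rsum (square K) (fun j => fst (phi (fst j) (snd j) v))).
  { intros v; rewrite dpartial_square, lsum_fst; apply rsum_ext; intros j _.
    rewrite mono_RtoC, pow1; simpl; ring. }
  rewrite E in HN1, HN2.
  pose proof (rsum_term_le (square K)
    (fun j => fst (phi (fst j) (snd j) gone) - fst (phi (fst j) (snd j) u)) (m, n)) as H.
  rewrite rsum_sub in H; simpl fst in H at 1; simpl in H.
  assert (fst (phi m n gone) - fst (phi m n u) <=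
    rsum (square K) (fun j => fst (phi (fst j) (snd j) gone)) -
    rsum (square K) (fun j => fst (phi (fst j) (snd j) u))); [|lra].
  apply H; [|apply in_square; simpl; lia].
  intros j _; pose proof (pdL_bound _ u (phi_pd (fst j) (snd j))).
  pose proof (fst_le_Cmod (phi (fst j) (snd j) u)).
  pose proof (Rle_abs (fst (phi (fst j) (snd j) u))); lra.
Qed.

(** By [pd_increment_bound], oscillation near [u0] is controlled by the drop of the real part from
    the neutral element to u^(-1) u0, and that drop by the corresponding one of f(1, .), which is
    continuous. *)
Lemma coefficient_cont m n : contL (phi m n).
Proof.
  intros u0 eps Heps; set (A := fst (phi m n gone)).
  destruct (pdL_gone _ (phi_pd m n)) as [_ HA]; fold A in HA.
  (* With A + 1 instead of A the product [A * D] is strictly below eps^2, also when A = 0. *)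
  set (D := eps ^ 2 / (A + 1)).
  assert (He2 : 0 < eps ^ 2) by (now apply pow_lt).
  assert (HD : 0 < D) by (apply Rdiv_lt_0_compat; lra).
  destruct (f_cont (RtoC 1) gone (D / 2) in_disc_1 ltac:(lra))
    as (delta & V & Hdelta & HVo & HVe & HV).
  destruct (gmul_cont _ (ginv u0) u0 V HVo) as (V1 & V2 & HV1o & _ & HV1 & HV2 & HV12);
    [now rewrite gmulVl|].
  exists (fun u => V1 (ginv u)); split; [now apply ginv_cont|]; split; [exact HV1|].
  intros u Hu.
  pose proof (coefficient_increment m n (gmul (ginv u) u0)) as Hinc.
  assert (Hf : Cmod (f (RtoC 1) (gmul (ginv u) u0) - f (RtoC 1) gone)%Cx < D / 2).
  { apply HV; [apply in_disc_1 | | now apply HV12].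
    replace (_ - _)%Cx with C0 by ring; now rewrite Cmod_C0. }
  apply Rle_lt_trans with (1 := fst_le_Cmod _) in Hf; apply Rabs_def2 in Hf.
  cbn [fst Csub] in Hf.
  pose proof (pd_increment_bound _ gone u u0 D (phi_pd m n)) as H.
  cbv beta in H; rewrite !gmul_ginv_gone, !gmulVl in H.
  specialize (H eq_refl eq_refl HD ltac:(lra)); fold A in H.
  apply Rnot_le_lt; intros Hle.
  assert (H2 : eps ^ 2 <= Cmod (phi m n u - phi m n u0)%Cx ^ 2) by (apply pow_incr; lra).
  assert (H3 : A * D < eps ^ 2); [|lra].
  replace (eps ^ 2) with ((A + 1) * D) by (unfold D; field; lra); lra.
Qed.

End ClosedDisc.

(** * Boundedness on the sphere and the characterisation *)

Lemma two_sphere_unit (c : nat -> Cx) :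
  (Cmod (c 0%nat) ^ 2 + Cmod (c 1%nat) ^ 2 = 1) ->
  csum 2 (fun k => c k * Cconj (c k))%Cx = RtoC 1.
Proof.
  intros H; simpl csum; rewrite !Cmul_conj; apply Cx_eq; simpl in *; lra.
Qed.

(** The kernel has constant diagonal f(1, e), and any [z] in the closed disc is the hermitian
    product of two unit vectors of C^2. *)
Lemma P_Omega_bound {L : LCGroup} (f : Cx -> L -> Cx) z u :
  P_Omega 2 f -> in_disc z -> Cmod (f z u) <= fst (f (RtoC 1) gone).
Proof.
  intros [_ H] Hz; unfold in_disc in Hz; pose proof (Cmod_ge_0 z) as Hz0.
  (* The first coordinate of [eta] is conjugated because [herm] conjugates its second argument; the
     square root completes it to a unit vector. *)
  set (xi := fun k : nat => match k with O => RtoC 1 | _ => C0 end).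
  set (eta := fun k : nat => match k with O => Cconj z | _ => RtoC (sqrt (1 - Cmod z ^ 2)) end).
  assert (Hxi : csum 2 (fun k => xi k * Cconj (xi k))%Cx = RtoC 1).
  { apply two_sphere_unit; simpl; rewrite Cmod_RtoC_pos, Cmod_C0; lra. }
  assert (Heta : csum 2 (fun k => eta k * Cconj (eta k))%Cx = RtoC 1).
  { apply two_sphere_unit; unfold eta; rewrite Cmod_conj, Cmod_RtoC_pos by apply sqrt_pos.
    rewrite pow2_sqrt by nra; ring. }
  assert (H1 : f (herm 2 xi xi) (gmul (ginv gone) gone) = f (herm 2 eta eta) (gmul (ginv u) u) ->
    Cmod (f (herm 2 xi eta) (gmul (ginv gone) u)) <= fst (f (herm 2 xi xi) (gmul (ginv gone) gone)))
    by exact (pd_bound _ (exist _ xi Hxi : Omega 2, gone) (exist _ eta Heta : Omega 2, u) H).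
  change (herm 2 xi xi = RtoC 1) in Hxi; change (herm 2 eta eta = RtoC 1) in Heta.
  rewrite Hxi, Heta, !gmulVl, gmul_ginv_gone in H1.
  replace (herm 2 xi eta) with z in H1; [auto|].
  apply Cx_eq; simpl; ring.
Qed.

Lemma P_Omega_inf_expansion {L : LCGroup} (f : Cx -> L -> Cx) :
  contDL f -> P_Omega_inf f -> exists phi, expansion phi f.
Proof.
  intros Hf HP; set (B := fst (f (RtoC 1) gone)).
  assert (HB : forall z u, in_disc z -> Cmod (f z u) <= B)
    by (intros z u; apply P_Omega_bound, HP; lia).
  destruct (polynomial_limit (fun N => tuples (dual N) N) degree (fourier f) f B)
    as (phi & Hpd & Hmass & Hcv).
  (* Positive definiteness is given on the spheres of dimension parameter at least 2. *)
  { exists 2%nat; intros N k HN; apply pd_fourier; [lia | now apply HP]. }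
  { intros z u; apply fourier_sum_cv with B; auto. }
  { intros r Hr; apply Cmod_fourier_sum_le; [exact HB|]; rewrite Cmod_RtoC_pos; lra. }
  (* The masses increase and are bounded by f(1, e), hence summability at the neutral element. *)
  destruct (growing_cv (mass phi)) as [a Ha].
  { now apply mass_growing. }
  { exists B; intros x [K ->]; apply Hmass. }
  exists phi; split; [|split].
  { intros m n; split; [now apply (coefficient_cont f phi a) | apply Hpd]. }
  { exists a; apply (Un_cv_ext (mass phi)); [intros; symmetry; apply csum_mass | exact Ha]. }
  { intros z u; now apply (closed_cv f phi a). }
Qed.

Theorem theorem1p5 (L : LCGroup) (f : Cx -> L -> Cx) (hf : contDL f) :
  (P_Omega_inf f <-> exists phi : nat -> nat -> L -> Cx, expansion phi f) /\
  (forall phi : nat -> nat -> L -> Cx, expansion phi f -> unif_cv phi f).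
Proof.
  split; [split|].
  { now apply P_Omega_inf_expansion. }
  { intros [phi Hphi] q _; now apply expansion_P_Omega with phi. }
  { intros phi; apply expansion_unif_cv. }
Qed.
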